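(* Let $T$ be NIP, $A$ a $\downarrow^f$-extension base, and suppose $\downarrow^f$ is left totally trivial over $A$. Then the following are equivalent for tuples $a,b$: (1) $a\downarrow^{\mathrm{st}}_A b$; (2) $a\downarrow^f_A b$ and $b\downarrow^f_A a$; (3) the set $\{a,b\}$ is strictly independent over $A$.
   Context: $T$ is a complete first-order theory and $\mathbb{M}\models T$ is a sufficiently saturated and homogeneous monster model; ''small'' means of size less than the saturation of $\mathbb{M}$. Tuples are small tuples of elements of $\mathbb{M}$, parameter sets are small subsets of $\mathbb{M}$, a global type is a complete type over $\mathbb{M}$, and juxtaposition denotes concatenation / union. A formula $\varphi(x,b)$ with parameters in $\mathbb{M}$ divides over a small set $A$ if there is an $A$-indiscernible sequence $(b_i)_{i\in\omega}$ with $b_i\equiv_A b$ such that $\{\varphi(x,b_i):i\in\omega\}$ is inconsistent. It forks over $A$ if it implies a finite disjunction of formulas (with parameters in $\mathbb{M}$), each dividing over $A$. A (possibly large) partial type forks over $A$ if it implies a formula which forks over $A$. Write $a\downarrow^f_A b$ if $\operatorname{tp}(a/Ab)$ does not fork over $A$. A small set $A$ is a $\downarrow^f$-extension base if $a\downarrow^f_A A$ for all tuples $a$. The relation $\downarrow^f$ is left totally trivial over $A$ if for all tuples $\bar a,\bar b,\bar c$, $\bar a\downarrow^f_A\bar c$ and $\bar b\downarrow^f_A\bar c$ imply $\bar a\bar b\downarrow^f_A\bar c$. Strict non-forking: $a\downarrow^{\mathrm{st}}_A b$ if there is a global type $p$ extending $\operatorname{tp}(a/Ab)$ which does not fork over $A$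 and such that for any small $B\supseteq Ab$, if $c\models p|_B$ then $\operatorname{tp}(B/Ac)$ does not fork over $A$. Sequences $(I_i:i\in S)$ are mutually indiscernible over $A$ if each $I_i$ is indiscernible over $A\cup\bigcup_{j\neq i}I_j$. A set (indexed family) of tuples $\{b_i:i\in S\}$ is strictly independent over $A$ if for any (infinite) $A$-indiscernible sequences $I_i$ such that $b_i$ is an element of $I_i$ for all $i\in S$, there exist sequences $I_i'\equiv_{Ab_i}I_i$ such that $(I_i':i\in S)$ are mutually indiscernible over $A$. *)

(* Defs.v *)
From HB Require Import structures.
From mathcomp Require Import all_boot all_order.
From mathcomp Require Import boolp classical_sets functions cardinality.

Set Implicit Arguments.
Unset Strict Implicit.
Unset Printing Implicit Defensive.

Local Open Scope classical_set_scope.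
Local Open Scope card_scope.

Record language := Language {
  fsym : Type;
  farity : fsym -> nat;
  rsym : Type;
  rarity : rsym -> nat }.

Inductive term (L : language) (V : Type) : Type :=
| Var (v : V)
| App (f : fsym L) (t : 'I_(farity f) -> term L V).

(* [formula L V] is the type of L-formulas with free variables in V;
   a quantifier binds the variable [None] of [option V]. *)
Inductive formula (L : language) (V : Type) : Type :=
| Bot
| Eq (t u : term L V)
| Rel (r : rsym L) (t : 'I_(rarity r) -> term L V)
| Imp (phi psi : formula L V)
| All (phi : formula L (option V)).

Arguments Bot {L V}.

Definition Not L (V : Type) (phi : formula L V) := Imp phi Bot.

Fixpoint term_rename L (V W : Type) (f : V -> W) (t : term L V) : term L W :=
  match t with
  | Var v => Var L (f v)
  | App g u => App (fun i => term_rename f (u i))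
  end.

Fixpoint rename L (V W : Type) (f : V -> W) (phi : formula L V) : formula L W :=
  match phi with
  | Bot => Bot
  | Eq t u => Eq (term_rename f t) (term_rename f u)
  | Rel r t => Rel (fun i => term_rename f (t i))
  | Imp phi psi => Imp (rename f phi) (rename f psi)
  | All phi => All (rename (omap f) phi)
  end.

Fixpoint term_fv L (V : Type) (t : term L V) : set V :=
  match t with
  | Var v => [set v]
  | App _ u => [set v | exists i, term_fv (u i) v]
  end.

Fixpoint fv L (V : Type) (phi : formula L V) : set V :=
  match phi with
  | Bot => set0
  | Eq t u => term_fv t `|` term_fv u
  | Rel _ t => [set v | exists i, term_fv (t i) v]
  | Imp phi psi => fv phi `|` fv psi
  | All phi => [set v | fv phi (Some v)]
  end.

Record structure (L : language) := Structure {
  carrier :> Type;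
  carrier_inhabited : inhabited carrier;
  fun_interp : forall f : fsym L, ('I_(farity f) -> carrier) -> carrier;
  rel_interp : forall r : rsym L, ('I_(rarity r) -> carrier) -> Prop }.

Fixpoint eval L (M : structure L) (V : Type) (e : V -> M) (t : term L V) : M :=
  match t with
  | Var v => e v
  | App f u => @fun_interp L M f (fun i => eval e (u i))
  end.

Fixpoint sat L (M : structure L) (V : Type) (e : V -> M) (phi : formula L V) : Prop :=
  match phi with
  | Bot => False
  | Eq t u => eval e t = eval e u
  | Rel r t => @rel_interp L M r (fun i => eval e (t i))
  | Imp phi psi => sat e phi -> sat e psi
  | All phi => forall m : M, sat (fun o => if o is Some v then e v else m) phi
  end.

Definition theory (L : language) := set (formula L void).

Definition models L (M : structure L) (T : theory L) : Prop :=
  forall phi, T phi -> sat (@of_void M) phi.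

Definition complete_theory L (T : theory L) : Prop :=
  (exists M : structure L, models M T) /\
  forall phi : formula L void,
    (forall M : structure L, models M T -> sat (@of_void M) phi) \/
    (forall M : structure L, models M T -> sat (@of_void M) (Not phi)).

Definition cat_tuple (M X Y : Type) (a : X -> M) (b : Y -> M) : X + Y -> M :=
  fun v => match v with inl x => a x | inr y => b y end.

Definition has_IP L (M : structure L) m n (phi : formula L ('I_m + 'I_n)) : Prop :=
  exists (a : nat -> 'I_m -> M) (b : set nat -> 'I_n -> M),
    forall (i : nat) (s : set nat), sat (cat_tuple (a i) (b s)) phi <-> s i.

Definition NIP L (T : theory L) : Prop :=
  forall M : structure L, models M T ->
  forall m n (phi : formula L ('I_m + 'I_n)), ~ has_IP M phi.

(* A formula in the variables X with parameters in M is a term of type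
   [formula L (X + M)], where [inr m] stands for the parameter m. *)

Section Types.
Variables (L : language) (M : structure L).

Definition holds (X : Type) (c : X -> M) (phi : formula L (X + M)) : Prop :=
  sat (cat_tuple c id) phi.

Definition over (X : Type) (B : set M) (phi : formula L (X + M)) : Prop :=
  forall m, fv phi (inr m) -> B m.

(* phi(x,b) *)
Definition inst (X Y : Type) (phi : formula L (X + Y)) (b : Y -> M) : formula L (X + M) :=
  rename (fun v => match v with inl x => inl x | inr y => inr (b y) end) phi.

Definition tp (X : Type) (a : X -> M) (B : set M) : set (formula L (X + M)) :=
  [set phi | over B phi /\ holds a phi].

Definition restrict (X : Type) (p : set (formula L (X + M))) (B : set M) :
    set (formula L (X + M)) :=
  [set phi | p phi /\ over B phi].

Definition realizes (X : Type) (c : X -> M) (p : set (formula L (X + M))) : Prop :=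
  forall phi, p phi -> holds c phi.

Definition consistent (X : Type) (p : set (formula L (X + M))) : Prop :=
  forall n (phi : 'I_n -> formula L (X + M)), (forall i, p (phi i)) ->
  exists c : X -> M, forall i, holds c (phi i).

Definition global_type (X : Type) (p : set (formula L (X + M))) : Prop :=
  consistent p /\ forall phi, p phi \/ p (Not phi).

(* Consequence modulo the elementary diagram of M; since p may be a type over
   all of M, it is not enough to look at realizations of p in M. *)
Definition implies (X : Type) (p : set (formula L (X + M))) (psi : formula L (X + M)) : Prop :=
  exists n (phi : 'I_n -> formula L (X + M)), (forall i, p (phi i)) /\
  forall c : X -> M, (forall i, holds c (phi i)) -> holds c psi.

Definition indiscernible d (I : orderType d) (X : Type) (A : set M) (a : I -> X -> M) : Prop :=
  forall n (i j : 'I_n -> I),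
    (forall k l : 'I_n, (k < l)%N -> (i k < i l)%O) ->
    (forall k l : 'I_n, (k < l)%N -> (j k < j l)%O) ->
    tp (fun u : 'I_n * X => a (i u.1) u.2) A = tp (fun u : 'I_n * X => a (j u.1) u.2) A.

Definition divides (X : Type) (A : set M) (phi : formula L (X + M)) : Prop :=
  exists n (psi : formula L (X + 'I_n)) (b : 'I_n -> M), phi = inst psi b /\
  exists bs : nat -> 'I_n -> M,
    [/\ indiscernible A bs,
        forall i, tp (bs i) A = tp b A &
        ~ consistent [set inst psi (bs i) | i in [set: nat]]].

Definition formula_forks (X : Type) (A : set M) (phi : formula L (X + M)) : Prop :=
  exists n (psi : 'I_n -> formula L (X + M)), (forall i, divides A (psi i)) /\
  forall c : X -> M, holds c phi -> exists i, holds c (psi i).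

Definition forks (X : Type) (A : set M) (p : set (formula L (X + M))) : Prop :=
  exists phi, implies p phi /\ formula_forks A phi.

(* a is independent from the set B over A; a tuple b on the right is
   represented by [range b]. *)
Definition nonforking (X : Type) (a : X -> M) (A B : set M) : Prop :=
  ~ forks A (tp a (A `|` B)).

End Types.

(* The saturation of the monster model is the cardinality of a type K. *)

Definition card_lt (T U : Type) (A : set T) (B : set U) : Prop := (A #<= B) /\ ~ (B #<= A).

Definition small_set (K T : Type) (A : set T) : Prop := card_lt A [set: K].

Definition small (K X : Type) : Prop := small_set K [set: X].

Definition strong_limit (K : Type) : Prop :=
  forall X : Type, small K X -> small K (set X).

Definition saturated (K : Type) L (M : structure L) : Prop :=
  forall (X : Type) (B : set M) (p : set (formula L (X + M))),
    small K X -> small_set K B -> p `<=` over B -> consistent p ->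
    exists c : X -> M, realizes c p.

Definition automorphism L (M : structure L) (s : M -> M) : Prop :=
  [/\ bijective s,
      forall (f : fsym L) (t : 'I_(farity f) -> M),
        s (fun_interp t) = fun_interp (fun i => s (t i)) &
      forall (r : rsym L) (t : 'I_(rarity r) -> M),
        rel_interp t <-> rel_interp (fun i => s (t i))].

Definition homogeneous (K : Type) L (M : structure L) : Prop :=
  forall (X : Type) (a b : X -> M), small K X -> tp a set0 = tp b set0 ->
  exists s : M -> M, automorphism s /\ forall x, s (a x) = b x.

(* [formula L nat] has cardinality |L| + aleph_0. *)
Definition monster (K : Type) L (M : structure L) : Prop :=
  [/\ strong_limit K, small K (formula L nat), saturated K M & homogeneous K M].

Section Independence.
Variables (K : Type) (L : language) (M : structure L).

Definition extension_base (A : set M) : Prop :=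
  small_set K A /\
  forall (X : Type) (a : X -> M), small K X -> nonforking a A A.

Definition left_totally_trivial (A : set M) : Prop :=
  forall (X Y Z : Type) (a : X -> M) (b : Y -> M) (c : Z -> M),
    small K X -> small K Y -> small K Z ->
    nonforking a A (range c) -> nonforking b A (range c) ->
    nonforking (cat_tuple a b) A (range c).

(* tp(B/Ac) is the type of the tuple which enumerates B by itself. *)
Definition strict_nonforking (X Y : Type) (a : X -> M) (A : set M) (b : Y -> M) : Prop :=
  exists p : set (formula L (X + M)),
    [/\ global_type p,
        tp a (A `|` range b) `<=` p,
        ~ forks A p &
        forall B : set M, small_set K B -> A `|` range b `<=` B ->
        forall c : X -> M, realizes c (restrict p B) ->
        nonforking (fun m : B => val m) A (range c)].

Definition seq_tuple (J X : Type) (I : J -> X -> M) : J * X -> M :=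
  fun u => I u.1 u.2.

Definition mutually_indiscernible (S : Type) (d : S -> Order.disp_t)
    (J : forall s, orderType (d s)) (X : S -> Type)
    (A : set M) (I : forall s, J s -> X s -> M) : Prop :=
  forall s, indiscernible
    (A `|` [set m | exists t, t <> s /\ range (seq_tuple (I t)) m]) (I s).

(* Sequences are indexed by arbitrary small infinite linear orders. *)
Definition strictly_independent (S : Type) (X : S -> Type)
    (b : forall s, X s -> M) (A : set M) : Prop :=
  forall (d : S -> Order.disp_t) (J : forall s, orderType (d s))
         (I : forall s, J s -> X s -> M),
    (forall s, small K (J s)) ->
    (forall s, infinite_set [set: J s]) ->
    (forall s, indiscernible A (I s)) ->
    (forall s, exists j, I s j = b s) ->
    exists I' : forall s, J s -> X s -> M,
      (forall s, tp (seq_tuple (I' s)) (A `|` range (b s)) =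
                 tp (seq_tuple (I s)) (A `|` range (b s))) /\
      mutually_indiscernible A I'.

Definition pair_index (X Y : Type) (s : bool) : Type := if s then X else Y.

Definition pair_family (X Y : Type) (a : X -> M) (b : Y -> M) :
    forall s, pair_index X Y s -> M :=
  fun s => if s return pair_index X Y s -> M then a else b.

End Independence.

(* Main.v *)
Require Import Defs.
From mathcomp Require Import all_boot all_order.
From mathcomp Require Import zify.
From mathcomp Require Import boolp classical_sets functions cardinality.

Set Implicit Arguments.
Unset Strict Implicit.
Unset Printing Implicit Defensive.

Local Open Scope classical_set_scope.

(** Say that [a] is independent from [b], [indep a b] below, when the type of [a]
    over [A] and [b] does not fork over [A]. Left total triviality lets a tuple be
    checked for independence entry by entry, so constructions with sequences can
    treat one term at a time. Everything is stated for predicates definable over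
    [A], and [nonforkingP] makes the link with the given definitions.

    From two-sided independence to strict independence of the set
    ([indep_strictly_independent]). The type of [a] over [b] does not divide, so a
    sequence through [b] can be moved to be indiscernible over [a] ([indep_move]).
    Its terms have the type of [b] over [a], hence are independent from [a], and so
    is the whole sequence by triviality. Now a sequence through [a] can be moved to
    be indiscernible over the first one, and an extraction by Ramsey's theorem
    makes the two mutually indiscernible.

    In the other direction, taking one sequence constant shows that the types do
    not divide. The core of the proof is that forking is dividing over [A]
    ([covered_dividing]). It rests on an elimination argument
    ([eliminate_dividing]), a simple form of the broom lemma of Chernikov and
    Kaplan that triviality makes available. By NIP, a formula [psi(x,e)] that
    divides does so along a sequence [c] in the type of [e] whose terms are
    independent from the earlier ones ([dividing_independent]). If [d] is
    independent from [e], this sequence can be made indiscernible over [d]; when a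
    disjunction of [psi(x,e)] with other formulas, some over [d] and some dividing
    over [e], is conjugated along it and intersected, the formulas [psi] drop out.
    Since [d] and the later terms of [c] are independent from each term, the other
    dividing formulas can be removed in the same way.

    Elimination gives, first, extension on the left ([indep_left_ext]): if [a] is
    independent from [b], any [c] has a conjugate over [a] that is independent from
    [b]. Second, for any [b] and [w] there is a conjugate of [b] which is
    independent from [w] and from which [w] is independent ([strict_pair]). Hence
    there are sequences of terms independent from one another in both directions;
    along these Kim's lemma holds ([dividing_strict]), and with it forking is
    dividing.

    Finally, if [a] and [b] are independent from each other and [d] is any tuple,
    a conjugate of [a] over [b] is independent from [d], and [d] from it
    ([strict_ext]). By compactness these conditions define a global type, which
    witnesses strict nonforking; by triviality it is enough to control the elements
    of the monster one by one. *)

Local Notation "a +++ b" := (Defs.cat_tuple a b) (at level 50, left associativity).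
Local Notation lt_nat := (fun i j : nat => is_true (i < j)%N).
Local Notation incr R i := (forall k l : 'I__, (k < l)%N -> R (i k) (i l)).

(** * Small types *)

Definition embeds (T U : Type) : Prop := exists f : T -> U, injective f.

Lemma card_leTP (T U : Type) : card_le [set: T] [set: U] <-> embeds T U.
Proof.
split=> [/card_leP[f]|[f finj]].
  exists (fun x => val (f (SigSub (mem_set (I : [set: T] x))))) => x y /val_inj.
  have xT z : z \in [set: [set: T]] by rewrite in_setT.
  by move=> /(inj (xT _) (xT _)) /(congr1 val).
have /injfunPex [h] : exists2 g : T -> U, set_fun setT setT g & set_inj setT g.
  by exists f => // x y _ _; apply: finj.
exact: inj_card_le h.
Qed.

(** A maximal partial injection is total on one side. *)
Lemma embeds_total (T U : Type) : embeds T U \/ embeds U T.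
Proof.
pose P (G : set (T * U)) := (forall t u u', G (t, u) -> G (t, u') -> u = u') /\
  (forall t t' u, G (t, u) -> G (t', u) -> t = t').
have [F FP Ftot|G [[Gf Gi] Gmax]] := @Zorn_bigcup _ P.
  split=> [t u u'|t t' u] [X FX Xx] [Y FY Yx]; have [XY|YX] := Ftot X Y FX FY.
  - exact: ((FP _ FY).1 _ _ _ (XY _ Xx) Yx).
  - exact: ((FP _ FX).1 _ _ _ Xx (YX _ Yx)).
  - exact: ((FP _ FY).2 _ _ _ (XY _ Xx) Yx).
  - exact: ((FP _ FX).2 _ _ _ Xx (YX _ Yx)).
have [/choice[f fG]|] := pselect (forall t, exists u, G (t, u)).
  by left; exists f => x y fxy; apply: (Gi _ _ (f x)) => //; rewrite fxy.
move=> /existsNP[t tG].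
have [/choice[f fG]|] := pselect (forall u, exists t, G (t, u)).
  by right; exists f => x y fxy; apply: (Gf (f x)) => //; rewrite fxy.
move=> /existsNP[u uG].
case: (Gmax (G `|` [set (t, u)])).
  split=> [p|]; first by left.
  by move=> /(_ (t, u)) /= H; apply: tG; exists u; apply: H; right.
split=> [t1 u1 u2|t1 t2 u1] [G1|E1] [G2|E2].
- exact: Gf G1 G2.
- by case: tG; exists u1; case: E2 => <- _.
- by case: tG; exists u2; case: E1 => <- _.
- by case: E1 E2 => _ -> [_ ->].
- exact: Gi G1 G2.
- by case: uG; exists t1; case: E2 => _ <-.
- by case: uG; exists t2; case: E1 => _ <-.
- by case: E1 E2 => -> _ [-> _].
Qed.

Section Small.
Variables (L : language) (K : Type) (M : structure L).
Hypothesis (hM : monster K M).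

Lemma small_embeds (T U : Type) : embeds T U -> small K U -> small K T.
Proof.
move=> /card_leTP TU [UK KU]; split; first exact: card_le_trans TU UK.
by move=> KT; apply: KU; exact: card_le_trans KT TU.
Qed.

Lemma small_pow (T : Type) : small K T -> small K (set T).
Proof. by case: hM => + _ _ _; apply. Qed.

Lemma embeds_square (T : Type) : embeds (T * T) (set (set T)).
Proof.
exists (fun p => [set S | S = [set p.1] \/ S = [set p.1; p.2]]).
move=> [x y] [x' y'] /= E.
have xx' : x = x'.
  have : [set S | S = [set x'] \/ S = [set x'; y']] [set x] by rewrite -E; left.
  case=> H; first by have : [set x'] x by rewrite -H.
  by have : [set x] x' by rewrite H; left.
subst x'; congr (_, _).
have : [set S | S = [set x] \/ S = [set x; y']] [set x; y] by rewrite -E; right.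
have : [set S | S = [set x] \/ S = [set x; y]] [set x; y'] by rewrite E; right.
case=> H [] H'.
- have -> : y = x by have : [set x] y by rewrite -H'; right.
  by have : [set x] y' by rewrite -H; right.
- have : [set x] y' by rewrite -H; right.
  move=> /= yx; have [-> //|-> //] : [set x; y'] y by rewrite -H'; right.
- have : [set x] y by rewrite -H'; right.
  move=> /= yx; have [-> //|-> //] : [set x; y] y' by rewrite -H; right.
have [yx|//] : [set x; y'] y by rewrite -H'; right.
have [-> //|-> //] : [set x; y] y' by rewrite -H; right.
Qed.

(** The larger factor dominates the product, by Kuratowski pairs, up to two power
    sets, which a strong limit absorbs. *)
Lemma small_prod (T U : Type) : small K T -> small K U -> small K (T * U).
Proof.
have main V W : embeds V W -> small K W -> small K (V * W) /\ small K (W * V).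
  move=> [f finj] sW; have sWW : small K (W * W).
    by apply: small_embeds (embeds_square W) _; do 2!apply: small_pow.
  split; apply: small_embeds sWW.
    by exists (fun p => (f p.1, p.2)) => -[? ?] [? ?] /= [/finj -> ->].
  by exists (fun p => (p.1, f p.2)) => -[? ?] [? ?] /= [-> /finj ->].
move=> sT sU; have [TU|UT] := embeds_total T U; first by case: (main _ _ TU sU).
by case: (main _ _ UT sT).
Qed.

Lemma small_nat : small K nat.
Proof.
case: hM => _ sF _ _; apply: small_embeds sF.
by exists (fun n => Eq (Var L n) (Var L n)) => n m [].
Qed.

Lemma small_bool : small K bool.
Proof. by apply: small_embeds small_nat; exists nat_of_bool => -[] []. Qed.

Lemma small_unit : small K unit.
Proof. by apply: small_embeds small_nat; exists (fun=> 0%N) => -[] []. Qed.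

Lemma small_void : small K void.
Proof. by apply: small_embeds small_nat; exists (fun=> 0%N) => -[]. Qed.

Lemma small_ord n : small K 'I_n.
Proof. by apply: small_embeds small_nat; exists (@nat_of_ord n); exact: val_inj. Qed.

Lemma small_sum (T U : Type) : small K T -> small K U -> small K (T + U).
Proof.
have main V W : embeds V W -> small K W -> small K (V + W)%type /\ small K (W + V)%type.
  move=> [f finj] sW; have sWW := small_prod small_bool sW.
  split; apply: small_embeds sWW.
    exists (fun p => match p with inl x => (true, f x) | inr y => (false, y) end).
    by move=> [x|x] [y|y] //= [] => [/finj|] ->.
  exists (fun p => match p with inr x => (true, f x) | inl y => (false, y) end).
  by move=> [x|x] [y|y] //= [] => [|/finj] ->.
move=> sT sU; have [TU|UT] := embeds_total T U; first by case: (main _ _ TU sU).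
by case: (main _ _ UT sT).
Qed.

Lemma small_set_type (T : Type) (B : set T) : small_set K B <-> small K B.
Proof.
have E : card_eq [set: B] B by exact: card_setT.
by split=> -[BK KB]; split; rewrite ?(card_le_eql E) ?(card_le_eqr E) //;
  rewrite -?(card_le_eql E) -?(card_le_eqr E).
Qed.

Lemma small_range (T U : Type) (f : T -> U) : small K T -> small_set K (range f).
Proof.
move=> [TK KT]; split; first exact: card_le_trans (card_image_le _ _) TK.
by move=> H; apply: KT; exact: card_le_trans H (card_image_le _ _).
Qed.

Lemma small_setU (T : Type) (B C : set T) :
  small_set K B -> small_set K C -> small_set K (B `|` C).
Proof.
move=> /small_set_type sB /small_set_type sC.
suff -> : B `|` C = range (fun u : B + C => match u with inl x => val x | inr x => val x end).
  exact/small_range/small_sum.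
apply/seteqP; split=> [x [Bx|Cx]|x [[y|y] _ <-]].
- by exists (inl (SigSub (mem_set Bx))).
- by exists (inr (SigSub (mem_set Cx))).
- by left; exact/set_mem/valP.
- by right; exact/set_mem/valP.
Qed.

End Small.

Local Hint Resolve small_nat small_void small_ord small_unit small_sum small_prod : small.
Ltac sm := solve [eauto 10 with small].

(** * Definable sets *)

Section Syntax.
Variables (L : language) (M : structure L).

Lemma eval_rename (V W : Type) (f : V -> W) (e : W -> M) (t : term L V) :
  eval e (term_rename f t) = eval (e \o f) t.
Proof. by elim: t => [//|g u IH] /=; congr fun_interp; apply/funext. Qed.

Lemma sat_rename (V W : Type) (f : V -> W) (e : W -> M) (phi : formula L V) :
  sat e (rename f phi) <-> sat (e \o f) phi.
Proof.
elim: phi W f e => {V} [V|V t u|V r t|V phi IHp psi IHq|V phi IH] W f e //=.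
- by rewrite !eval_rename.
- suff -> : (fun i => eval e (term_rename f (t i))) = fun i => eval (e \o f) (t i) by [].
  by apply/funext => i; exact: eval_rename.
- by rewrite IHp IHq.
- split=> H m; move: (H m); rewrite IH.
    by congr (sat _ _); apply/funext => -[].
  by congr (sat _ _); apply/funext => -[].
Qed.

Lemma eval_fv (V : Type) (e e' : V -> M) (t : term L V) :
  (forall v, term_fv t v -> e v = e' v) -> eval e t = eval e' t.
Proof.
elim: t => [v|g u IH] /= H; first exact: H.
by congr fun_interp; apply/funext => i; apply: IH => v Hv; apply: H; exists i.
Qed.

Lemma sat_fv (V : Type) (e e' : V -> M) (phi : formula L V) :
  (forall v, fv phi v -> e v = e' v) -> sat e phi <-> sat e' phi.
Proof.
elim: phi e e' => {V} [V|V t u|V r t|V phi IHp psi IHq|V phi IH] e e' //= H.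
- by rewrite (@eval_fv _ e e' t) ?(@eval_fv _ e e' u) // => v ?; apply: H; [right|left].
- suff -> : (fun i => eval e (t i)) = fun i => eval e' (t i) by [].
  by apply/funext => i; apply: eval_fv => v ?; apply: H; exists i.
- by rewrite (IHp e e') ?(IHq e e') // => v ?; apply: H; [right|left].
- have E m : sat (fun o => if o is Some v then e v else m) phi <->
             sat (fun o => if o is Some v then e' v else m) phi.
    by apply: IH => -[v|] // ?; apply: H.
  by split=> HH m; apply/E.
Qed.

Lemma term_fv_rename (V W : Type) (f : V -> W) (t : term L V) w :
  term_fv (term_rename f t) w -> exists2 v, term_fv t v & f v = w.
Proof.
elim: t => [v|g u IH] /=; first by exists v.
by move=> [i /IH[v ? ?]]; exists v => //; exists i.
Qed.

Lemma fv_rename (V W : Type) (f : V -> W) (phi : formula L V) w :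
  fv (rename f phi) w -> exists2 v, fv phi v & f v = w.
Proof.
elim: phi W f w => {V} [V|V t u|V r t|V phi IHp psi IHq|V phi IH] W f w //=.
- by case=> H; have [v ? ?] := term_fv_rename H; exists v => //; [left|right].
- by case=> i H; have [v ? ?] := term_fv_rename H; exists v => //; exists i.
- by case=> H; [have [v ? ?] := IHp _ _ _ H|have [v ? ?] := IHq _ _ _ H];
    exists v => //; [left|right].
- by move=> H; have [[v|//] ? /= [<-]] := IH _ _ _ H; exists v.
Qed.

(** Indexed by a finite type rather than an ordinal, so that unions are indexed by
    sums and sigma types. *)
Definition fin_covered (V : Type) (S : set V) :=
  exists (F : finType) (f : F -> V), forall v, S v -> exists i, f i = v.

Lemma fin_coveredU (V : Type) (S T : set V) :
  fin_covered S -> fin_covered T -> fin_covered (S `|` T).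
Proof.
move=> [F [f fP]] [G [g gP]].
exists (F + G)%type, (fun u => match u with inl i => f i | inr i => g i end) => v.
by move=> [/fP[i <-]|/gP[i <-]]; [exists (inl i)|exists (inr i)].
Qed.

Lemma fin_covered_bigU (V : Type) n (S : 'I_n -> set V) :
  (forall i, fin_covered (S i)) -> fin_covered [set v | exists i, S i v].
Proof.
move=> SP; pose F i := projT1 (cid (SP i)).
pose f i : F i -> V := projT1 (cid (projT2 (cid (SP i)))).
exists {i : 'I_n & F i}, (fun u => f (tag u) (tagged u)) => v [i Sv].
have [j <-] := projT2 (cid (projT2 (cid (SP i)))) v Sv.
by exists (Tagged F j).
Qed.

Lemma term_fv_fin (V : Type) (t : term L V) : fin_covered (term_fv t).
Proof.
elim: t => [v|g u IH] /=; last exact: fin_covered_bigU.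
by exists unit, (fun=> v) => w ->; exists tt.
Qed.

Lemma fv_fin (V : Type) (phi : formula L V) : fin_covered (fv phi).
Proof.
elim: phi => {V} [V|V t u|V r t|V phi IHp psi IHq|V phi IH] /=.
- by exists void, (@of_void _).
- by apply: fin_coveredU; exact: term_fv_fin.
- by apply: fin_covered_bigU => i; exact: term_fv_fin.
- exact: fin_coveredU.
case: IH => F [f fP].
have [v0|V0] := pselect (exists v : V, True); last by
  exists void, (@of_void _) => v; case: V0; exists v.
case: v0 => v0 _; exists F, (fun i => if f i is Some v then v else v0) => v /fP.
by move=> [i fi]; exists i; rewrite fi.
Qed.

End Syntax.

Section Definable.
Variables (L : language) (M : structure L).
Implicit Types (A B : set M) (V W X Y : Type).

(** Predicates on tuples, rather than formulas, so that logical equivalence is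
    equality and substitution is composition. *)
Definition definable A V (P : (V -> M) -> Prop) : Prop :=
  exists phi : formula L (V + M), Defs.over A phi /\ forall e, holds e phi <-> P e.

Lemma dfn_ext A V (P Q : (V -> M) -> Prop) :
  (forall e, P e <-> Q e) -> definable A P -> definable A Q.
Proof. by move=> PQ [phi [Aphi phiP]]; exists phi; split=> // e; rewrite phiP. Qed.

Lemma dfn_mono A B V (P : (V -> M) -> Prop) :
  A `<=` B -> definable A P -> definable B P.
Proof. by move=> AB [phi [Aphi phiP]]; exists phi; split=> // m /Aphi /AB. Qed.

Lemma dfn_False A V : definable A (fun _ : V -> M => False).
Proof. by exists Bot; split. Qed.

Lemma dfn_imp A V (P Q : (V -> M) -> Prop) :
  definable A P -> definable A Q -> definable A (fun e => P e -> Q e).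
Proof.
move=> [phi [Aphi phiP]] [psi [Apsi psiP]]; exists (Imp phi psi).
split=> [m [/Aphi|/Apsi] //|e]; by rewrite -phiP -psiP.
Qed.

Lemma dfn_not A V (P : (V -> M) -> Prop) :
  definable A P -> definable A (fun e => ~ P e).
Proof. by move=> dP; apply: dfn_imp dP _; exact: dfn_False. Qed.

Lemma dfn_and A V (P Q : (V -> M) -> Prop) :
  definable A P -> definable A Q -> definable A (fun e => P e /\ Q e).
Proof.
move=> dP dQ; apply: (@dfn_ext A V (fun e => ~ (P e -> ~ Q e))).
  by move=> e; have [?|?] := pselect (P e); have [?|?] := pselect (Q e); tauto.
by apply: dfn_not; apply: dfn_imp => //; exact: dfn_not.
Qed.

Lemma dfn_or A V (P Q : (V -> M) -> Prop) :
  definable A P -> definable A Q -> definable A (fun e => P e \/ Q e).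
Proof.
move=> dP dQ; apply: (@dfn_ext A V (fun e => ~ P e -> Q e)).
  by move=> e; have [?|?] := pselect (P e); tauto.
by apply: dfn_imp => //; exact: dfn_not.
Qed.

Lemma dfn_iff A V (P Q : (V -> M) -> Prop) :
  definable A P -> definable A Q -> definable A (fun e => P e <-> Q e).
Proof. by move=> dP dQ; apply: dfn_and; exact: dfn_imp. Qed.

Lemma dfn_cst A V (P : Prop) : definable A (fun _ : V -> M => P).
Proof.
have [p|np] := pselect P.
  by apply: (@dfn_ext A V (fun=> ~ False)); [tauto|exact/dfn_not/dfn_False].
by apply: (@dfn_ext A V (fun=> False)); [tauto|exact/dfn_False].
Qed.

Lemma dfn_eq A V (v w : V) : definable A (fun e : V -> M => e v = e w).
Proof. by exists (Eq (Var L (inl v)) (Var L (inl w))); split=> // m /= [] []. Qed.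

Lemma dfn_subst_mx A V W (s : V -> W + M) (P : (V -> M) -> Prop) :
  (forall v m, s v = inr m -> A m) -> definable A P ->
  definable A (fun e : W -> M => P (fun v => (e +++ id) (s v))).
Proof.
move=> sA [phi [Aphi phiP]].
exists (rename (fun u => match u with inl v => s v | inr m => inr m end) phi); split.
  move=> m H; have [[v|m'] ? E] := fv_rename H; first exact: sA E.
  by case: E => <-; exact: Aphi.
move=> e; rewrite /holds sat_rename -phiP /holds.
suff -> : (e +++ id) \o (fun u : V + M => match u with inl v => s v | inr m => inr m end) =
   (fun v => (e +++ id) (s v)) +++ id by [].
by apply/funext => -[].
Qed.

(** The premise says that [F] only rearranges, repeats or drops entries; stated
    entrywise, it is proved by case analysis on the variables. *)
Lemma dfn_sub A V W (F : (W -> M) -> (V -> M)) (P : (V -> M) -> Prop) :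
  definable A P -> (forall v, exists w, forall e, F e v = e w) ->
  definable A (fun e => P (F e)).
Proof.
move=> dP /choice[f Ff].
have := @dfn_subst_mx A V W (fun v => inl (f v)) P (fun _ _ => ltac:(discriminate)) dP.
by apply: dfn_ext => e; suff -> : F e = fun v => (e +++ id) (inl (f v));
  last by apply/funext => v; rewrite Ff.
Qed.

Lemma dfn_plug A V W (w : W -> M) (P : (V + W -> M) -> Prop) :
  (forall i, A (w i)) -> definable A P -> definable A (fun e => P (e +++ w)).
Proof.
move=> Aw dP.
have := @dfn_subst_mx A _ V
  (fun u => match u with inl v => inl v | inr i => inr (w i) end) P _ dP.
have H : forall u m, match u with inl v => inl v | inr i => inr (w i) end = inr m :> V + M -> A m.
  by move=> [v|i] m // [<-].
move=> /(_ H); apply: dfn_ext => e.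
by suff -> : e +++ w = fun v => (e +++ id)
  (match v with inl v => inl v | inr i => inr (w i) end) by []; apply/funext => -[].
Qed.

Definition ext_opt V (e : V -> M) (m : M) : option V -> M :=
  fun o => if o is Some v then e v else m.

Lemma dfn_all_opt A V (P : (option V -> M) -> Prop) :
  definable A P -> definable A (fun e : V -> M => forall m, P (ext_opt e m)).
Proof.
move=> [phi [Aphi phiP]].
pose f (u : option V + M) : option (V + M) :=
  match u with inl None => None | inl (Some v) => Some (inl v) | inr m => Some (inr m) end.
exists (All (rename f phi)); split.
  by move=> m /= H; have [[[v|]|m'] ? //= [<-]] := fv_rename H; exact: Aphi.
move=> e; have E m : sat (fun o => if o is Some v then (e +++ id) v else m) (rename f phi)
    <-> P (ext_opt e m).
  rewrite sat_rename -phiP /holds.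
  suff -> : (fun o => if o is Some v then (e +++ id) v else m) \o f =
    ext_opt e m +++ id by [].
  by apply/funext => -[[v|]|].
by split=> H m; apply/E.
Qed.

Lemma dfn_ex_opt A V (P : (option V -> M) -> Prop) :
  definable A P -> definable A (fun e : V -> M => exists m, P (ext_opt e m)).
Proof.
move=> dP; have := dfn_not (dfn_all_opt (dfn_not dP)); apply: dfn_ext => e.
by split=> [/existsNP[m /contrapT]|[m Pm] /(_ m)//]; exists m.
Qed.

(** In [y \o f \o g] all but finitely many entries of [y] are overwritten by those
    that matter; a form of finite support that asks neither for injectivity of [f]
    nor for decidable equality of variables. *)
Lemma dfn_support A X Y (P : (X + Y -> M) -> Prop) : definable A P ->
  exists n (f : 'I_n -> Y) (g : Y -> 'I_n),
  forall x y, P (x +++ y) <-> P (x +++ (y \o f \o g)).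
Proof.
move=> [phi [_ phiP]].
have [[y0 _]|Y0] := pselect (exists y : Y, True); last first.
  have f : 'I_0 -> Y by case.
  have g : Y -> 'I_0 by move=> y; case: Y0; exists y.
  exists 0%N, f, g => x y.
  by suff <- : y = y \o f \o g by []; apply/funext => y1; case: Y0; exists y1.
have [F [f fP]] := fv_fin phi.
pose h (o : option F) := if o is Some i then (if f i is inl (inr y) then y else y0) else y0.
have /choice[g gP] : forall y, exists o : option F, fv phi (inl (inr y)) -> h o = y.
  move=> y; have [/fP[i fi]|?] := pselect (fv phi (inl (inr y))).
    by exists (Some i) => _ /=; rewrite fi.
  by exists None.
exists #|{: option F}|, (h \o enum_val), (enum_rank \o g) => x y; rewrite -!phiP.
by apply: sat_fv => -[[v|v]|m] //= ?; rewrite enum_rankK gP.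
Qed.

Lemma dfn_ex_fin A V n (P : (V + 'I_n -> M) -> Prop) : definable A P ->
  definable A (fun e => exists w, P (e +++ w)).
Proof.
elim: n V P => [|n IH] V P dP.
  have w0 : 'I_0 -> M by move=> [].
  have := @dfn_plug A V 'I_0 w0 P _ dP.
  move=> /(_ ltac:(case=> //)); apply: dfn_ext => e; split=> [?|[w]]; first by exists w0.
  by suff -> : w = w0 by []; apply/funext => -[].
pose P' (e : option V + 'I_n -> M) := P ((e \o inl \o Some) +++
  (fun i => if unlift ord0 i is Some j then e (inr j) else e (inl None))).
have dP' : definable A P'.
  apply: dfn_sub dP _ => -[v|i] /=; first by exists (inl (Some v)).
  by case: unliftP => [j _|_]; [exists (inr j)|exists (inl None)].
have := dfn_ex_opt (IH _ _ dP'); apply: dfn_ext => e; split=> [[m [w Pw]]|[w Pw]].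
  by eexists; exact: Pw.
exists (w ord0), (w \o lift ord0); rewrite /P'.
suff <- : e +++ w = (((ext_opt e (w ord0) +++ (w \o lift ord0)) \o inl \o Some) +++
     (fun i : 'I_n.+1 =>
      match unlift ord0 i with
      | Some j => (ext_opt e (w ord0) +++ (w \o lift ord0)) (inr j)
      | None => (ext_opt e (w ord0) +++ (w \o lift ord0)) (inl None)
      end)) by [].
apply/funext => -[//|i] /=.
by case: unliftP => [j ->|->].
Qed.

(** Only the finitely many quantified variables that occur matter. *)
Lemma dfn_ex A V W (P : (V + W -> M) -> Prop) : definable A P ->
  definable A (fun e => exists w, P (e +++ w)).
Proof.
move=> dP; have [n [f [g PE]]] := dfn_support dP.
pose P' (e : V + 'I_n -> M) := P ((e \o inl) +++ (e \o inr \o g)).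
have dP' : definable A P'.
  by apply: dfn_sub dP _ => -[v|w] /=; [exists (inl v)|exists (inr (g w))].
have := dfn_ex_fin dP'; apply: dfn_ext => e; split=> [[w Pw]|[w /PE Pw]].
  by exists (w \o g).
by exists (w \o f).
Qed.

Lemma dfn_all A V W (P : (V + W -> M) -> Prop) : definable A P ->
  definable A (fun e => forall w, P (e +++ w)).
Proof.
move=> dP; have := dfn_not (dfn_ex (dfn_not dP)); apply: dfn_ext => e.
by split=> [/forallNP H w|H [w /(_ (H w))] //]; exact: contrapT (H w).
Qed.

Lemma dfn_ball A V n (P : 'I_n -> (V -> M) -> Prop) :
  (forall i, definable A (P i)) -> definable A (fun e => forall i, P i e).
Proof.
elim: n P => [|n IH] P dP.
  by apply: (dfn_ext _ (dfn_cst A V True)) => e; split=> // _ [].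
have := dfn_and (dP ord0) (IH (fun i => P (lift ord0 i)) (fun i => dP _)).
apply: dfn_ext => e; split=> [[P0 PS] i|H //].
by case: (unliftP ord0 i) => [j|] ->.
Qed.

Lemma dfn_bex A V n (P : 'I_n -> (V -> M) -> Prop) :
  (forall i, definable A (P i)) -> definable A (fun e => exists i, P i e).
Proof.
move=> dP; have := dfn_not (dfn_ball (fun i => dfn_not (dP i))); apply: dfn_ext => e.
by split=> [/existsNP[i /contrapT]|[i Pi] /(_ i)//]; exists i.
Qed.

(** Parameters outside [A] are traded for variables, so that [A] can be fixed. *)
Lemma dfn_param A X W (w : W -> M) (P : (X -> M) -> Prop) :
  definable (A `|` range w) P <->
  exists2 Q : (X + W -> M) -> Prop, definable A Q & forall x, P x <-> Q (x +++ w).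
Proof.
split=> [[phi [Aphi phiP]]|[Q dQ PQ]]; last first.
  apply: (@dfn_ext _ _ (fun x => Q (x +++ w))) => [x|]; first by rewrite PQ.
  apply: dfn_plug => [i|]; first by right; exists i.
  by apply: dfn_mono dQ => m; left.
have /choice[s sP] : forall m, exists u : (X + W) + M, fv phi (inr m) ->
    (u = inr m /\ A m) \/ (exists2 i, u = inl (inr i) & w i = m).
  move=> m; have [/Aphi[Am|[i _ wi]]|?] := pselect (fv phi (inr m)).
  - by exists (inr m) => _; left.
  - by exists (inl (inr i)) => _; right; exists i.
  - by exists (inr m).
pose f (u : X + M) := match u with inl x => inl (inl x) | inr m => s m end.
exists (fun e => holds e (rename f phi)).
  exists (rename f phi); split; last by [].
  move=> m H; have [[x|m'] Hm' sm'] := fv_rename H; first by [].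
  by case: (sP _ Hm') => [[E Am]|[i E _]]; move: sm'; rewrite /f E // => -[<-].
move=> x; rewrite -phiP /holds sat_rename; apply: sat_fv => -[v|m] //= Hm.
by case: (sP _ Hm) => [[->]|[i -> <-]].
Qed.

End Definable.

(** * Sequences of natural numbers *)

Definition increasing (h : nat -> nat) := forall i j, (i < j)%N -> (h i < h j)%N.

Lemma increasing_comp h g : increasing h -> increasing g -> increasing (h \o g).
Proof. by move=> hi gi i j /gi /hi. Qed.

Lemma increasingS h : (forall i, (h i < h i.+1)%N) -> increasing h.
Proof.
move=> hS i j; elim: j => // j IH; rewrite ltnS leq_eqVlt => /predU1P[->|/IH] //.
by move=> /ltn_trans; apply.
Qed.

(** Lets each term of a sequence be chosen in terms of all the earlier ones; [R n]
    may only look at the first [n] terms of its sequence. *)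
Lemma dependent_choice (T : Type) (t0 : T) (R : nat -> (nat -> T) -> T -> Prop) :
  (forall n h h' t, (forall k, (k < n)%N -> h k = h' k) -> R n h t -> R n h' t) ->
  (forall n h, (forall k, (k < n)%N -> R k h (h k)) -> exists t, R n h t) ->
  exists f, forall n, R n f (f n).
Proof.
move=> Rloc Rex.
have /choice[F FP] : forall nh : nat * (nat -> T), exists t,
    (forall k, (k < nh.1)%N -> R k nh.2 (nh.2 k)) -> R nh.1 nh.2 t.
  move=> [n h] /=; have [/Rex[t Rt]|?] := pselect (forall k, (k < n)%N -> R k h (h k)).
    by exists t.
  by exists t0.
pose l := fix l n := if n is m.+1 then rcons (l m) (F (m, nth t0 (l m))) else [::].
have sl n : size (l n) = n by elim: n => //= n IH; rewrite size_rcons IH.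
pose f n := F (n, nth t0 (l n)).
have lf n k : (k < n)%N -> nth t0 (l n) k = f k.
  elim: n => // n IH; rewrite ltnS leq_eqVlt => /predU1P[->|kn] /=.
    by rewrite nth_rcons sl ltnn eqxx.
  by rewrite nth_rcons sl kn IH.
exists f; elim/ltn_ind => n IH; apply: (Rloc _ (nth t0 (l n))); first exact: lf.
apply: (FP (n, nth t0 (l n))) => /= k kn; rewrite lf //.
by apply: (Rloc _ f) (IH _ kn) => j jk; rewrite lf // (ltn_trans jk kn).
Qed.

Lemma infinite_subsequence (P : nat -> Prop) :
  (forall n, exists m, (n <= m)%N /\ P m) -> exists h, increasing h /\ forall i, P (h i).
Proof.
move=> Pinf.
pose R n (f : nat -> nat) t := P t /\ forall k, (k < n)%N -> (f k < t)%N.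
have [||h hP] := @dependent_choice nat 0%N R.
- by move=> n f f' t ff' [Pt H]; split=> // k kn; rewrite -ff' // H.
- move=> n f _; have [m [nm Pm]] := Pinf (\max_(k < n) f k).+1.
  exists m; split=> // k kn; apply: leq_trans nm; rewrite ltnS.
  exact: (leq_bigmax (Ordinal kn)).
exists h; split=> [|i]; last by case: (hP i).
by move=> i j ij; case: (hP j) => _; apply.
Qed.

Lemma pigeonhole_inf n (c : nat -> 'I_n) :
  exists i h, increasing h /\ forall k, c (h k) = i.
Proof.
apply: contrapT => /forallNP H.
have /choice[b bP] : forall i, exists b, forall m, (b <= m)%N -> c m <> i.
  move=> i; apply: contrapT => /forallNP Hi; apply: (H i).
  have [k|h [hi hP]] := @infinite_subsequence (fun m => c m = i); last by exists h.
  have /existsNP[m] := Hi k.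
  by move=> /not_implyP[km /contrapT ?]; exists m.
exact: (bP (c (\max_i b i)) (\max_i b i)) (leq_bigmax _) erefl.
Qed.

Lemma pigeonhole_prop (P : nat -> Prop) :
  exists h, increasing h /\ forall i j, P (h i) <-> P (h j).
Proof.
have [i [h [hi hc]]] := @pigeonhole_inf 2 (fun k => if `[< P k >] then ord0 else ord_max).
exists h; split=> // k l; have := hc k; rewrite -(hc l).
by do 2!case: asboolP.
Qed.

(** The sequences [G k] thin out so that the color of a tuple starting with [x k]
    no longer depends on its other entries; the pigeonhole principle then takes
    care of the first entry. *)
Lemma ramsey_seq n (C : seq nat -> Prop) :
  exists h, increasing h /\ forall s t, size s = n -> size t = n ->
    sorted ltn s -> sorted ltn t -> C (map h s) <-> C (map h t).
Proof.
elim: n C => [|n IH] C; first by exists id; split=> // -[|//] [|//].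
have /choice[H HP] := fun g : nat -> nat => IH (fun s => C (g 0%N :: map (fun i => g i.+1) s)).
pose G := fix G k := if k is m.+1 then (fun i => G m (H (G m) i).+1) else id.
have Gi k : increasing (G k).
  by elim: k => //= k IHk i j ij; apply: IHk; rewrite ltnS; apply: (HP _).1.
pose x k := G k 0%N.
have Gsub k m i : exists j, G (k + m)%N i = G k j.
  elim: m i => [|m IHm] i; first by exists i; rewrite addn0.
  by rewrite addnS /=; exact: IHm.
have xi : increasing x.
  by apply: increasingS => k; rewrite /x /=; apply: Gi.
pose b k := C (G k 0%N :: map (fun i => G k i.+1) (map (H (G k)) (iota 0 n))).
have xb k t : size t = n -> path ltn k t -> C (x k :: map x t) <-> b k.
  move=> st kt; have /allP kall : all (ltn k) t.
    by move: kt; rewrite path_sortedE; [case/andP|exact: ltn_trans].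
  have /choice[s0 s0P] : forall i, exists j, (k < i)%N -> x i = G k.+1 j.
    move=> i; have [ki|_] := ltnP k i; last by exists 0%N.
    by have [j Ej] := Gsub k.+1 (i - k.+1)%N 0%N; exists j; rewrite -Ej subnKC.
  have -> : map x t = map (fun i => G k i.+1) (map (H (G k)) (map s0 t)).
    rewrite -!map_comp; apply/eq_in_map => i it; apply: s0P; exact: kall.
  apply: (HP (G k)).2; rewrite ?size_map ?size_iota ?iota_ltn_sorted //.
  suff: sorted (relpre (G k.+1) ltn) (map s0 t).
    apply: sub_sorted => u v /=; have [//|/(Gi k.+1)|->] := ltngtP u v; last by rewrite ltnn.
    by move=> vu uv; have := ltn_trans vu uv; rewrite ltnn.
  rewrite -sorted_map -map_comp.
  suff -> : map (G k.+1 \o s0) t = map x t.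
    rewrite sorted_map; apply: sub_sorted (path_sorted kt) => u v; exact: xi.
  by apply/eq_in_map => i it; apply/esym/s0P; exact: kall.
have [u [ui ub]] := pigeonhole_prop b.
exists (x \o u); split; first exact: increasing_comp.
move=> [|k s] [|l t] //= [ss] [st] ks lt.
have mono r m : path ltn m r -> path ltn (u m) (map u r).
  by rewrite path_map; apply: sub_path => ? ?; exact: ui.
rewrite !(map_comp x u) !xb ?size_map //; exact: mono.
Qed.

Lemma ramsey n (C : ('I_n -> nat) -> Prop) :
  exists h, increasing h /\ forall i j : 'I_n -> nat,
    (forall k l : 'I_n, (k < l)%N -> (i k < i l)%N) ->
    (forall k l : 'I_n, (k < l)%N -> (j k < j l)%N) -> C (h \o i) <-> C (h \o j).
Proof.
have [h [hi hP]] := ramsey_seq n (fun s => C (fun k => nth 0%N s k)).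
exists h; split=> // i j ii ji.
pose S (f : 'I_n -> nat) := map f (enum 'I_n).
have sS f : size (S f) = n by rewrite size_map size_enum_ord.
have oS f : (forall k l : 'I_n, (k < l)%N -> (f k < f l)%N) -> sorted ltn (S f).
  move=> fi; rewrite sorted_map; have : sorted ltn (map val (enum 'I_n)).
    by rewrite val_enum_ord iota_ltn_sorted.
  by rewrite sorted_map; apply: sub_sorted => k l; exact: fi.
have ES f : (fun k : 'I_n => nth 0%N (map h (S f)) k) = h \o f.
  apply/funext => k; rewrite (nth_map 0%N) ?sS // (nth_map k) ?size_enum_ord //.
  by rewrite nth_ord_enum.
by rewrite -!ES; apply: hP; rewrite ?sS // ?oS.
Qed.

Lemma ramsey_fin N (m : 'I_N -> nat) (C : forall k, ('I_(m k) -> nat) -> Prop) :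
  exists h, increasing h /\ forall k (i j : 'I_(m k) -> nat),
    (forall a b : 'I_(m k), (a < b)%N -> (i a < i b)%N) ->
    (forall a b : 'I_(m k), (a < b)%N -> (j a < j b)%N) -> C k (h \o i) <-> C k (h \o j).
Proof.
elim: N m C => [|N IH] m C; first by exists id; split=> // -[].
have [g [gi gP]] := IH _ (fun k => C (lift ord0 k)).
have [h [hi hP]] := ramsey (fun i : 'I_(m ord0) -> nat => C ord0 (g \o i)).
exists (g \o h); split; first exact: increasing_comp.
move=> k; case: (unliftP ord0 k) => [k'|] -> i j ii ij; last exact: hP.
by apply: (gP k' (h \o i) (h \o j)) => a b ?; apply: hi; [exact: ii|exact: ij].
Qed.

(** * Types over a fixed small set *)

(* Finds the variable that a given entry of a rearranged tuple comes from. *)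
Ltac vars :=
  solve [ let rec go := first
    [ eexists; intro; reflexivity
    | match goal with
      | v : (_ + _)%type |- _ => destruct v; go
      | v : (_ * _)%type |- _ => destruct v; go
      | v : void |- _ => destruct v
      | v : option _ |- _ => destruct v; go
      end ] in intros; go ].

Lemma cat_tuple_eta (X Y M : Type) (e : X + Y -> M) : (e \o inl) +++ (e \o inr) = e.
Proof. by apply/funext => -[]. Qed.

Section Types.
Variables (L : language) (K : Type) (M : structure L) (hM : monster K M).
Variables (A : set M) (sA : small_set K A).

(** Equality of types over [A]; that over [A] and a tuple [w] is
    [eqt (a +++ w) (b +++ w)]. *)
Definition eqt V (a b : V -> M) := forall P, definable A P -> P a -> P b.

Lemma eqt_refl V (a : V -> M) : eqt a a. Proof. by []. Qed.

Lemma eqt_iff V (a b : V -> M) P : eqt a b -> definable A P -> P a <-> P b.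
Proof.
move=> ab dP; split; first exact: ab.
by move=> Pb; apply: contrapT => nPa; exact: (ab _ (dfn_not dP)).
Qed.

Lemma eqt_sym V (a b : V -> M) : eqt a b -> eqt b a.
Proof. by move=> ab P dP /(eqt_iff ab dP). Qed.

Lemma eqt_trans V (a b c : V -> M) : eqt a b -> eqt b c -> eqt a c.
Proof. by move=> ab bc P dP /(ab P dP) /(bc P dP). Qed.

Lemma eqt_sub V W (F : (V -> M) -> (W -> M)) (a b : V -> M) :
  eqt a b -> (forall w, exists v, forall e, F e w = e v) -> eqt (F a) (F b).
Proof. by move=> ab Fv P dP; apply: (ab (fun e => P (F e))); exact: dfn_sub. Qed.

(** The equality of two entries is part of the type. *)
Lemma eqt_coord V (a b : V -> M) (v w : V) : eqt a b -> a v = a w -> b v = b w.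
Proof. by move=> ab; apply: (ab (fun e => e v = e w)); exact: dfn_eq. Qed.

Lemma eqtP V (a b : V -> M) : tp a A = tp b A <-> eqt a b.
Proof.
split=> [E P [phi [Aphi phiP]] /phiP Pa|ab].
  by apply/phiP; have : tp a A phi by []; rewrite E => -[].
have main c d : eqt c d -> tp c A `<=` tp d A.
  move=> cd phi [Aphi Hc]; split=> //; apply: (cd (fun e => holds e phi)) => //.
  by exists phi.
by apply/seteqP; split; apply: main => //; exact: eqt_sym.
Qed.

Lemma eqt_rangeP V W (a b : V -> M) (w : W -> M) :
  tp a (A `|` range w) = tp b (A `|` range w) <-> eqt (a +++ w) (b +++ w).
Proof.
split=> [E P dP Pa|ab].
  have [phi [Aphi phiP]] : definable (A `|` range w) (fun e => P (e +++ w)).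
    by apply/dfn_param; exists P.
  apply/phiP; have : tp a (A `|` range w) phi by split=> //; apply/phiP.
  by rewrite E => -[].
have main c d : eqt (c +++ w) (d +++ w) -> tp c (A `|` range w) `<=` tp d (A `|` range w).
  move=> cd phi [Aphi Hc]; split=> //.
  have [Q dQ QE] : exists2 Q, definable A Q & forall x, holds x phi <-> Q (x +++ w).
    by apply/dfn_param; exists phi.
  by apply/QE; apply: cd => //; apply/QE.
by apply/seteqP; split; apply: main => //; exact: eqt_sym.
Qed.

Lemma saturation X W (w : W -> M) (F : set ((X -> M) -> Prop)) :
  small K X -> small K W -> (forall Q, F Q -> definable (A `|` range w) Q) ->
  (forall n (Q : 'I_n -> _), (forall i, F (Q i)) -> exists x, forall i, Q i x) ->
  exists x, forall Q, F Q -> Q x.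
Proof.
move=> sX sW Fdef Ffin.
pose B := A `|` range w.
pose p := [set phi : formula L (X + M) | Defs.over B phi /\ F (fun e => holds e phi)].
have holdsE (Q : (X -> M) -> Prop) phi : (forall e, holds e phi <-> Q e) -> (fun e => holds e phi) = Q.
  by move=> H; apply/funext => e; apply/propext.
have [hsl _ hsat _] := hM.
have [|||x xp] := hsat X B p sX.
- exact: (small_setU hM sA (small_range _ sW)).
- by move=> phi [].
- by move=> n phi pphi; apply: (Ffin n (fun i e => holds e (phi i))) => i; case: (pphi i).
exists x => Q FQ; have [phi [Bphi phiP]] := Fdef Q FQ.
by apply/phiP; apply: xp; split=> //; rewrite (holdsE Q).
Qed.

(** The common form of the extension arguments: by compactness, only one formula of
    the type of [a] over [b] and one member of the ideal [J] have to be considered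
    at a time. *)
Lemma realize_avoid X Y W (a : X -> M) (b : Y -> M) (w : W -> M)
    (J : set ((X -> M) -> Prop)) :
  small K X -> small K Y -> small K W ->
  (forall Q, J Q -> definable (A `|` range w) Q) ->
  J (fun=> False) -> (forall Q Q', J Q -> J Q' -> J (fun x => Q x \/ Q' x)) ->
  (forall P Q, definable A P -> P (a +++ b) -> J Q -> exists x, P (x +++ b) /\ ~ Q x) ->
  exists x, eqt (a +++ b) (x +++ b) /\ forall Q, J Q -> ~ Q x.
Proof.
move=> sX sY sW Jdef J0 JU H.
pose F := [set R : (X -> M) -> Prop |
  (exists P, [/\ definable A P, P (a +++ b) & R = fun x => P (x +++ b)]) \/
  (exists2 Q, J Q & R = fun x => ~ Q x)].
have [||n R FR|x xF] := @saturation X (Y + W) (b +++ w) F sX.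
- exact: (small_sum hM).
- move=> R [[P [dP _ ->]]|[Q JQ ->]].
    apply: (@dfn_mono _ _ (A `|` range b)); first by
      move=> m [|[i _ <-]]; [left|right; exists (inl i)].
    by apply/dfn_param; exists P.
  apply: dfn_not; apply: dfn_mono (Jdef _ JQ) => m [|[i _ <-]]; [by left|right].
  by exists (inr i).
- have [P [Q [dP Pab JQ PQ]]] : exists P Q, [/\ definable A P, P (a +++ b), J Q &
      forall x, P (x +++ b) -> ~ Q x -> forall i, R i x].
    elim: n R FR => [|n IH] R FR.
      by exists (fun=> True), (fun=> False); split=> //; [exact: dfn_cst|move=> ? ? ? []].
    have [P [Q [dP Pab JQ PQ]]] := IH _ (fun i => FR (lift ord0 i)).
    have [[P' [dP' P'ab RE]]|[Q' JQ' RE]] := FR ord0.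
      exists (fun e => P e /\ P' e), Q; split=> //; first exact: dfn_and.
      move=> x [Px P'x] Qx i; case: (unliftP ord0 i) => [j ->|->]; first exact: PQ.
      by rewrite RE.
    exists P, (fun x => Q x \/ Q' x); split=> //; first exact: JU.
    move=> x Px Qx i; case: (unliftP ord0 i) => [j ->|->].
      by apply: PQ => // ?; apply: Qx; left.
    by rewrite RE => ?; apply: Qx; right.
  by have [x [Px Qx]] := H P Q dP Pab JQ; exists x; exact: PQ.
exists x; split=> [P dP Pab|Q JQ].
  by apply: (xF (fun x => P (x +++ b))); left; exists P.
by apply: (xF (fun x => ~ Q x)); right; exists Q.
Qed.

(** This replaces automorphisms in what follows. *)
Lemma eqt_extend V W (a b : V -> M) (c : W -> M) :
  small K V -> small K W -> eqt a b -> exists d, eqt (a +++ c) (b +++ d).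
Proof.
move=> sV sW ab.
pose F := [set R : (W -> M) -> Prop | exists P,
  [/\ definable A P, P (a +++ c) & R = fun y => P (b +++ y)]].
have [|n R FR|y yF] := @saturation W V b F sW sV.
- move=> R [P [dP _ ->]]; apply/dfn_param.
  exists (fun e => P ((e \o inr) +++ (e \o inl))) => //.
  by apply: dfn_sub dP _; vars.
- have /choice[P PP] := FR.
  have : exists y, forall i, P i (a +++ y) by exists c => i; case: (PP i).
  move=> /(ab (fun v => exists y, forall i, P i (v +++ y))) [|y yP].
    by apply: (dfn_ex (P := fun e => forall i, P i e)); apply: dfn_ball => i; case: (PP i).
  by exists y => i; case: (PP i) => _ _ ->.
exists y => P dP Pac.
by apply: (yF (fun y => P (b +++ y))); exists P.
Qed.

(** A relation rather than an order, so that the converse of an order is covered. *)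
Definition indisc J (R : J -> J -> Prop) Y W (w : W -> M) (a : J -> Y -> M) :=
  forall n (i j : 'I_n -> J), (forall k l : 'I_n, (k < l)%N -> R (i k) (i l)) ->
    (forall k l : 'I_n, (k < l)%N -> R (j k) (j l)) ->
    eqt ((fun u : 'I_n * Y => a (i u.1) u.2) +++ w) ((fun u : 'I_n * Y => a (j u.1) u.2) +++ w).

(** By compactness: any finite part of the conditions on [b] is met by the terms of
    [a] along a sequence of indices homogeneous for the predicates involved. *)
Lemma extract J (R : J -> J -> Prop) Y W (w : W -> M) (a : nat -> Y -> M) :
  small K J -> small K Y -> small K W ->
  (forall x, ~ R x x) -> (forall x y z, R x y -> R y z -> R x z) ->
  exists b : J -> Y -> M, indisc R w b /\
    forall n (P : ('I_n * Y + W -> M) -> Prop), definable A P ->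
    (forall i : 'I_n -> nat, (forall k l : 'I_n, (k < l)%N -> (i k < i l)%N) ->
      P ((fun u : 'I_n * Y => a (i u.1) u.2) +++ w)) ->
    forall j : 'I_n -> J, (forall k l : 'I_n, (k < l)%N -> R (j k) (j l)) ->
      P ((fun u : 'I_n * Y => b (j u.1) u.2) +++ w).
Proof.
move=> sJ sY sW Rirr Rtr.
pose sub I (c : I -> Y -> M) n (i : 'I_n -> I) : 'I_n * Y -> M := fun u => c (i u.1) u.2.
pose EM n (P : ('I_n * Y + W -> M) -> Prop) := forall i : 'I_n -> nat,
  (forall k l : 'I_n, (k < l)%N -> (i k < i l)%N) -> P (sub _ a n i +++ w).
pose D := {n : nat & ((('I_n * Y + W -> M) -> Prop) * (('I_n -> J) * ('I_n -> J)))%type}.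
pose Pd (d : D) := (projT2 d).1; pose id1 (d : D) := (projT2 d).2.1.
pose id2 (d : D) := (projT2 d).2.2.
pose F := [set Q : (J * Y -> M) -> Prop | exists d : D,
  [/\ definable A (Pd d),
      (forall k l : 'I_(tag d), (k < l)%N -> R (id1 d k) (id1 d l)),
      (forall k l : 'I_(tag d), (k < l)%N -> R (id2 d k) (id2 d l)) &
      Q = fun e => EM _ (Pd d) \/ Pd d (sub _ (fun s y => e (s, y)) _ (id1 d) +++ w) ->
                   Pd d (sub _ (fun s y => e (s, y)) _ (id2 d) +++ w)]].
have [Q [d [dP _ _ ->]]|N Q FQ|b bF] := @saturation (J * Y) W w F (small_prod hM sJ sY) sW.
- apply/dfn_param.
  exists (fun e => EM _ (Pd d) \/ Pd d (sub _ (fun s y => e (inl (s, y))) _ (id1 d) +++ (e \o inr)) ->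
                  Pd d (sub _ (fun s y => e (inl (s, y))) _ (id2 d) +++ (e \o inr))) => //.
  by apply: dfn_imp; [apply: dfn_or; first exact: dfn_cst|]; apply: dfn_sub dP _; vars.
- have /choice[d dP] := FQ.
  have [h [hi hP]] := ramsey_fin (fun k (i : 'I_(tag (d k)) -> nat) => Pd (d k) (sub _ a _ i +++ w)).
  (* An order-preserving map from the finitely many indices involved to the
     natural numbers: count the predecessors. *)
  pose T : finType := {k : 'I_N & ('I_(tag (d k)) + 'I_(tag (d k)))%type}.
  pose f (t : T) := match tagged t with inl i => id1 (d (tag t)) i | inr i => id2 (d (tag t)) i end.
  pose g j := #|[pred t : T | `[< R (f t) j >]]|.
  have gR t j : R (f t) j -> (g (f t) < g j)%N.
    move=> tj; apply/proper_card/properP; split.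
      by apply/fintype.subsetP => s; rewrite !inE => st; exact: Rtr st tj.
    by exists t; [rewrite inE|apply/negP; rewrite inE; exact: Rirr].
  exists (fun u => a (h (g u.1)) u.2) => k; have [_ R1 R2 ->] := dP k.
  have i1 (x y : 'I_(tag (d k))) : (x < y)%N -> (g (id1 (d k) x) < g (id1 (d k) y))%N.
    by move=> /R1; exact: (gR (Tagged _ (inl x : 'I_(tag (d k)) + 'I_(tag (d k))))).
  have i2 (x y : 'I_(tag (d k))) : (x < y)%N -> (g (id2 (d k) x) < g (id2 (d k) y))%N.
    by move=> /R2; exact: (gR (Tagged _ (inr x : 'I_(tag (d k)) + 'I_(tag (d k))))).
  case=> [HE|]; first by apply: (HE (fun x => h (g (id2 (d k) x)))) => x y xy; apply: hi; exact: i2.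
  by move=> H; apply/(hP k (g \o id2 (d k)) (g \o id1 (d k))).
exists (fun j y => b (j, y)); split=> [n i j ij jj P dP|n P dP HP j jj].
  move=> Pi; pose d : D := existT _ n (P, (i, j)).
  apply: (bF (fun e => EM _ (Pd d) \/ Pd d (sub _ (fun s y => e (s, y)) _ (id1 d) +++ w) ->
                   Pd d (sub _ (fun s y => e (s, y)) _ (id2 d) +++ w))); last by right.
  by exists d.
pose d : D := existT _ n (P, (j, j)).
apply: (bF (fun e => EM _ (Pd d) \/ Pd d (sub _ (fun s y => e (s, y)) _ (id1 d) +++ w) ->
                   Pd d (sub _ (fun s y => e (s, y)) _ (id2 d) +++ w))); last by left.
by exists d.
Qed.

End Types.

Section Forking.
Variables (L : language) (K : Type) (M : structure L) (hM : monster K M).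
Variables (A : set M) (sA : small_set K A).

Local Notation eqt := (eqt A).
Local Notation indisc := (indisc A).
Local Notation nul := (of_void M).

(** * Indiscernible sequences *)

(** What is used of an infinite linear order; it holds for the order itself or for
    its converse. *)
Record chain J (R : J -> J -> Prop) (h : nat -> J) : Prop := Chain {
  chain_irr : forall x, ~ R x x;
  chain_trans : forall x y z, R x y -> R y z -> R x z;
  chain_incr : forall i j : nat, (i < j)%N -> R (h i) (h j);
  chain_list : forall n (f : 'I_n -> J), exists m (i : 'I_m -> J),
    incr R i /\ forall k, exists l, i l = f k }.

Lemma chain_nat : chain lt_nat id.
Proof.
split=> //; first by move=> x; rewrite ltnn.
  by move=> x y z; exact: ltn_trans.
move=> n f; exists (\max_k f k).+1, (@nat_of_ord _); split=> // k.
by exists (Ordinal (leq_bigmax k : (f k < (\max_k f k).+1)%N)).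
Qed.

Lemma eqt_nul V (a b : V -> M) : eqt (a +++ nul) (b +++ nul) <-> eqt a b.
Proof.
split=> H; first by apply: (eqt_sub (F := fun e => e \o inl) H); vars.
have E (c : V -> M) : c +++ nul = fun u : V + void => match u with inl v => c v | inr v => nul v end by [].
by rewrite !E; apply: (eqt_sub (F := fun e (u : V + void) =>
   match u with inl v => e v | inr v => of_void M v end) H); vars.
Qed.

Lemma indisc_sub J (R : J -> J -> Prop) Y Y' W W' (f : Y' -> Y) (g : W' -> W) (w : W -> M) a :
  indisc R w a -> indisc R (w \o g) (fun j => a j \o f).
Proof.
move=> H n i j ii ij.
by have := eqt_sub (F := fun e => (fun u : 'I_n * Y' => e (inl (u.1, f u.2))) +++ (fun v => e (inr (g v))))
  (H n i j ii ij); apply; vars.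
Qed.

Lemma indisc_nul J (R : J -> J -> Prop) Y W (w : W -> M) (a : J -> Y -> M) :
  indisc R w a -> indisc R nul a.
Proof.
move=> H; have := @indisc_sub J R Y Y W void id (@of_void _) w a H.
by suff -> : w \o @of_void _ = nul by []; apply/funext => -[].
Qed.

Lemma indisc1 J (R : J -> J -> Prop) Y W (w : W -> M) (a : J -> Y -> M) i j :
  indisc R w a -> eqt (a i +++ w) (a j +++ w).
Proof.
move=> H; have := eqt_sub (F := fun e => (fun y : Y => e (inl (@ord0 0, y))) +++ (e \o inr))
  (H 1%N (fun=> i) (fun=> j) _ _); apply; try by vars.
  by move=> [[|//] ?] [[|//] ?].
by move=> [[|//] ?] [[|//] ?].
Qed.

Lemma indisc_reindex I J (R : J -> J -> Prop) (S : I -> I -> Prop) (h : I -> J) Y W (w : W -> M) (a : J -> Y -> M) :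
  (forall x y, S x y -> R (h x) (h y)) -> indisc R w a -> indisc S w (a \o h).
Proof.
by move=> hh H n i j ii ij; apply: (H n (h \o i) (h \o j)) => k l kl; apply: hh; [exact: ii|exact: ij].
Qed.

(** Only finitely many terms occur in a formula, and these can be listed
    increasingly. *)
Lemma eqt_chain J (R : J -> J -> Prop) h Y W (w w' : W -> M) (a b : J -> Y -> M) :
  chain R h ->
  (forall n (i : 'I_n -> J), incr R i -> eqt (seq_tuple (a \o i) +++ w) (seq_tuple (b \o i) +++ w')) ->
  eqt (seq_tuple a +++ w) (seq_tuple b +++ w').
Proof.
move=> [_ _ _ Rl] H P dP.
have dP' : definable A (fun e : W + J * Y -> M => P ((e \o inr) +++ (e \o inl))).
  by apply: dfn_sub dP _; vars.
have [n [f [g PE]]] := dfn_support dP'.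
have [m [i [ii /choice[l il]]]] := Rl n (fun k => (f k).1).
pose F (e : 'I_m * Y + W -> M) (u : J * Y + W) : M :=
  match u with inl jy => e (inl (l (g jy), (f (g jy)).2)) | inr v => e (inr v) end.
have FE (v : W -> M) c : P (seq_tuple c +++ v) <-> P (F (seq_tuple (c \o i) +++ v)).
  have -> : F (seq_tuple (c \o i) +++ v) = (seq_tuple c \o f \o g) +++ v.
    by apply/funext => -[jy|//] /=; rewrite /seq_tuple /= il.
  exact: (PE v (seq_tuple c)).
move=> /FE PF; apply/FE; apply: (H m i ii (fun e => P (F e))) => //.
by apply: dfn_sub dP _; vars.
Qed.

Lemma indisc_inv J (R : J -> J -> Prop) Y W (w w' : W -> M) (a b : J -> Y -> M) :
  eqt (seq_tuple a +++ w) (seq_tuple b +++ w') -> indisc R w a -> indisc R w' b.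
Proof.
move=> ab H n i j ii ij.
have S (k : 'I_n -> J) : eqt (seq_tuple (a \o k) +++ w) (seq_tuple (b \o k) +++ w').
  by apply: (eqt_sub (F := fun e => (fun u : 'I_n * Y => e (inl (k u.1, u.2))) +++ (e \o inr)) ab); vars.
exact: eqt_trans (eqt_sym (S i)) (eqt_trans (H n i j ii ij) (S j)).
Qed.

(** Indiscernibility over further parameters [w] is paid for by moving the sequence
    within its type over [A]; the last clause controls its relation to [w]. *)
Lemma extract_like J (R : J -> J -> Prop) h Y W (w : W -> M) (c : J -> Y -> M) :
  small K J -> small K Y -> small K W -> chain R h -> indisc R nul c ->
  exists b : J -> Y -> M, [/\ indisc R w b, eqt (seq_tuple c) (seq_tuple b) &
    forall n (P : ('I_n * Y + W -> M) -> Prop), definable A P ->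
    (forall i : 'I_n -> J, incr R i -> P (seq_tuple (c \o i) +++ w)) ->
    forall j : 'I_n -> J, incr R j -> P (seq_tuple (b \o j) +++ w)].
Proof.
move=> sJ sY sW Rh cI; have [Rirr Rtr hR _] := Rh.
have [b [bI bP]] := extract hM sA w (c \o h) sJ sY sW Rirr Rtr.
have bP' n (P : ('I_n * Y + W -> M) -> Prop) : definable A P ->
    (forall i : 'I_n -> J, incr R i -> P (seq_tuple (c \o i) +++ w)) ->
    forall j : 'I_n -> J, incr R j -> P (seq_tuple (b \o j) +++ w).
  move=> dP HP; apply: (bP n P dP) => i ii; apply: (HP (h \o i)) => k l kl.
  by apply: hR; exact: ii.
exists b; split=> //; apply/eqt_nul; apply: (eqt_chain Rh) => n i ii; apply/eqt_nul => P dP Pi.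
apply: (bP' n (fun e => P (e \o inl))) => //; first by apply: dfn_sub dP _; vars.
move=> j jj; suff /(eqt_nul _ _).1 H : eqt (seq_tuple (c \o i) +++ nul) (seq_tuple (c \o j) +++ nul).
  exact: H Pi.
exact: cI.
Qed.

(** * Dividing and forking, semantically *)

(** Finite inconsistency with an explicit bound, so that it is definable. *)
Definition inconsistent_along X Y (psi : (X + Y -> M) -> Prop) N (c : nat -> Y -> M) :=
  forall x, exists i : 'I_N, ~ psi (x +++ c i).

Definition dividing X Y (psi : (X + Y -> M) -> Prop) (e : Y -> M) :=
  exists es N, [/\ indisc lt_nat nul es, forall i, eqt e (es i) & inconsistent_along psi N es].

(** For definable sets, forking over [A]; the dividing formulas share one tuple [e]
    of parameters. *)
Definition covered X (Q : (X -> M) -> Prop) :=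
  exists m (e : 'I_m -> M) n (psi : nat -> (X + 'I_m -> M) -> Prop),
    (forall j, (j < n)%N -> definable A (psi j) /\ dividing (psi j) e) /\
    forall x, Q x -> exists2 j, (j < n)%N & psi j (x +++ e).

(** Nonforking of the type of [a] over [A] and [b], see [nonforkingP]. *)
Definition indep X Y (a : X -> M) (b : Y -> M) :=
  forall P, definable A P -> P (a +++ b) -> ~ covered (fun x => P (x +++ b)).

Lemma dfn_inconsistent X Y W (psi : (X + Y -> M) -> Prop) N (F : 'I_N -> (W -> M) -> (Y -> M)) :
  definable A psi -> (forall i y, exists w, forall e, F i e y = e w) ->
  definable A (fun e => forall x, exists i : 'I_N, ~ psi (x +++ F i e)).
Proof.
move=> dpsi FP.
apply: (dfn_all (P := fun e => exists i, ~ psi ((e \o inr) +++ F i (e \o inl)))).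
apply: dfn_bex => i; apply: dfn_not; apply: dfn_sub dpsi _ => -[x|y]; first by vars.
by have [w Fw] := FP i y; exists (inl w) => e /=; rewrite Fw.
Qed.

Lemma inconsistent_incr X Y (psi : (X + Y -> M) -> Prop) N c (i : 'I_N -> nat) :
  definable A psi -> indisc lt_nat nul c -> inconsistent_along psi N c ->
  incr lt_nat i -> forall x, exists k : 'I_N, ~ psi (x +++ c (i k)).
Proof.
move=> dpsi cI cN ii.
pose Q (e : 'I_N * Y -> M) := forall x, exists i : 'I_N, ~ psi (x +++ (fun y => e (i, y))).
have dQ : definable A Q by apply: dfn_inconsistent => // k y; vars.
have /eqt_nul H := cI N (@nat_of_ord N) i (fun k l kl => kl) ii.
exact: (H Q dQ cN).
Qed.

Lemma dividing_inv X Y (psi : (X + Y -> M) -> Prop) e e' :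
  eqt e e' -> dividing psi e -> dividing psi e'.
Proof.
move=> ee' [es [N [eI eE eN]]]; exists es, N; split=> // i.
exact: eqt_trans (eqt_sym ee') (eE i).
Qed.

(** The terms of the given sequence are completed to conjugates of [e], and the
    result is made indiscernible by extraction. *)
Lemma dividing_lift X Y Y' (f : Y' -> Y) (psi : (X + Y' -> M) -> Prop) (e : Y -> M) :
  small K Y -> small K Y' -> definable A psi -> dividing psi (e \o f) ->
  dividing (fun u => psi ((u \o inl) +++ (u \o inr \o f))) e.
Proof.
move=> sY sY' dpsi [es [N [eI eE eN]]].
have /choice[es' es'P] : forall i, exists e', eqt e e' /\ e' \o f = es i.
  move=> i; have [e' ee'] := eqt_extend hM sA e sY' sY (eE i).
  exists e'; split; first by apply: (eqt_sub (F := fun u => u \o inr) ee'); vars.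
  apply/funext => y; apply/esym.
  by apply: (eqt_coord (v := inl y) (w := inr (f y)) ee').
have [b [bI bP]] := extract hM sA nul es' (small_nat hM) sY (small_void hM)
  (chain_irr chain_nat) (chain_trans chain_nat).
exists b, N; split=> //.
  move=> j P dP Pe.
  apply: (bP 1%N (fun u => P (fun y => u (inl (ord0, y)))) _ _ (fun=> j)).
  - by apply: dfn_sub dP _; vars.
  - by move=> i _; apply: (es'P (i ord0)).1.
  - by move=> [[|//] ?] [[|//] ?].
pose Q (e : 'I_N * Y + void -> M) := forall x, exists i : 'I_N, ~ psi (x +++ (fun y => e (inl (i, f y)))).
apply: (bP N Q _ _ (@nat_of_ord N)) => //.
  by apply: dfn_inconsistent => // k y; vars.
move=> i ii x; have [k nk] := inconsistent_incr dpsi eI eN ii x; exists k.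
by have [_ E] := es'P (i k); rewrite /seq_tuple /= -[X in ~ psi (_ +++ X)]/(es' (i k) \o f) E.
Qed.

Lemma dividing_covered X Y (psi : (X + Y -> M) -> Prop) (e : Y -> M) (Q : (X -> M) -> Prop) :
  definable A psi -> dividing psi e -> (forall x, Q x -> psi (x +++ e)) -> covered Q.
Proof.
move=> dpsi [es [N [eI eE eN]]] Qpsi.
have [n [f [g PE]]] := dfn_support dpsi.
exists n, (e \o f), 1%N, (fun _ u => psi ((u \o inl) +++ (u \o inr \o g))); split.
  move=> _ _; split; first by apply: dfn_sub dpsi _; vars.
  exists (fun i => es i \o f), N; split.
  - by have := @indisc_sub _ _ Y 'I_n void void f id nul es eI; apply.
  - by move=> i; apply: (eqt_sub (F := fun u => u \o f) (eE i)); vars.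
  - by move=> x; have [i ni] := eN x; exists i => H; apply: ni; apply/PE.
by move=> x Qx; exists 0%N => //; apply: (PE x e).1; exact: Qpsi.
Qed.

Lemma covered_sub X (Q Q' : (X -> M) -> Prop) :
  (forall x, Q x -> Q' x) -> covered Q' -> covered Q.
Proof.
by move=> QQ' [m [e [n [psi [H1 H2]]]]]; exists m, e, n, psi; split=> // x /QQ' /H2.
Qed.

Lemma covered_False X : covered (fun _ : X -> M => False).
Proof. have e : 'I_0 -> M by case. by exists 0%N, e, 0%N, (fun _ _ => False). Qed.

Lemma covered_or X (Q Q' : (X -> M) -> Prop) :
  covered Q -> covered Q' -> covered (fun x => Q x \/ Q' x).
Proof.
move=> [m1 [e1 [n1 [p1 [H1 C1]]]]] [m2 [e2 [n2 [p2 [H2 C2]]]]].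
pose e i := match fintype.split i with inl k => e1 k | inr k => e2 k end.
have El : e \o @lshift m1 m2 = e1.
  by apply/funext => i /=; rewrite /e (unsplitK (inl i)).
have Er : e \o @rshift m1 m2 = e2.
  by apply/funext => i /=; rewrite /e (unsplitK (inr i)).
exists (m1 + m2)%N, e, (n1 + n2)%N, (fun j u => if (j < n1)%N
  then p1 j ((u \o inl) +++ (u \o inr \o @lshift m1 m2))
  else p2 (j - n1)%N ((u \o inl) +++ (u \o inr \o @rshift m1 m2))); split.
  move=> j jn; have [jn1|jn1] := ltnP j n1.
    have [d1 D1] := H1 _ jn1; split; first by apply: dfn_sub d1 _; vars.
    by apply: dividing_lift; rewrite ?El //; sm.
  have [|d2 D2] := H2 (j - n1)%N; first by rewrite ltn_subLR.
  split; first by apply: dfn_sub d2 _; vars.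
  by apply: dividing_lift; rewrite ?Er //; sm.
move=> x [/C1[j jn Hj]|/C2[j jn Hj]].
  exists j; first exact: ltn_addr.
  by rewrite jn -[X in p1 j (_ +++ X)]/(e \o @lshift m1 m2) El.
exists (n1 + j)%N; first by rewrite ltn_add2l.
by rewrite ltnNge leq_addr addKn -[X in p2 j (_ +++ X)]/(e \o @rshift m1 m2) Er.
Qed.

Lemma dfn_covering X Y Z n (Q : (X + Y -> M) -> Prop) (psi : nat -> (X + Z -> M) -> Prop) :
  definable A Q -> (forall j, (j < n)%N -> definable A (psi j)) ->
  definable A (fun u : Y + Z -> M => forall x, Q (x +++ (u \o inl)) ->
    exists2 j, (j < n)%N & psi j (x +++ (u \o inr))).
Proof.
move=> dQ dpsi.
apply: (dfn_all (P := fun u : (Y + Z) + X -> M => Q ((u \o inr) +++ (u \o inl \o inl)) ->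
  exists2 j, (j < n)%N & psi j ((u \o inr) +++ (u \o inl \o inr)))).
apply: dfn_imp; first by apply: dfn_sub dQ _; vars.
apply: (@dfn_ext _ _ _ _ (fun u : (Y + Z) + X -> M =>
  exists j : 'I_n, psi j ((u \o inr) +++ (u \o inl \o inr)))) => [u|].
  by split=> [[j pj]|[j jn pj]]; [exists j|exists (Ordinal jn)].
by apply: dfn_bex => j; apply: dfn_sub (dpsi j (ltn_ord j)) _; vars.
Qed.

Lemma covered_inv X Y (Q : (X + Y -> M) -> Prop) (b b' : Y -> M) : small K Y ->
  definable A Q -> eqt b b' -> covered (fun x => Q (x +++ b)) -> covered (fun x => Q (x +++ b')).
Proof.
move=> sY dQ bb' [m [e [n [psi [H C]]]]].
have [e' be'] := eqt_extend hM sA e sY (small_ord hM m) bb'.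
exists m, e', n, psi; split=> [j jn|x Qx].
  have [dj Dj] := H j jn; split=> //; apply: dividing_inv Dj.
  by apply: (eqt_sub (F := fun u => u \o inr) be'); vars.
exact: (be' _ (dfn_covering dQ (fun j jn => (H j jn).1)) C x Qx).
Qed.

Lemma covered_pull X X' (f : X' -> X) (Q : (X' -> M) -> Prop) :
  covered Q -> covered (fun x => Q (x \o f)).
Proof.
move=> [m [e [n [psi [H C]]]]].
exists m, e, n, (fun j u => psi j ((u \o inl \o f) +++ (u \o inr))); split.
  move=> j /H[dj [es [N [eI eE eN]]]]; split; first by apply: dfn_sub dj _; vars.
  by exists es, N; split=> // x; exact: (eN (x \o f)).
by move=> x /C[j jn pj]; exists j.
Qed.

Lemma inconsistent_eqt X Y (psi : (X + Y -> M) -> Prop) N (c c' : nat -> Y -> M) :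
  definable A psi -> eqt (seq_tuple c) (seq_tuple c') ->
  inconsistent_along psi N c -> inconsistent_along psi N c'.
Proof.
move=> dpsi cc' cN.
pose Q (u : nat * Y -> M) := forall x, exists i : 'I_N, ~ psi (x +++ (fun y => u (nat_of_ord i, y))).
have dQ : definable A Q by apply: dfn_inconsistent => // r y; vars.
exact: (cc' Q dQ cN).
Qed.

(** * Calculus of nonforking *)

Lemma indep_sub X Y X' Y' (f : X' -> X) (g : Y' -> Y) (a : X -> M) (b : Y -> M) :
  indep a b -> indep (a \o f) (b \o g).
Proof.
move=> ab P dP Pab cP.
apply: (ab (fun u => P ((u \o inl \o f) +++ (u \o inr \o g)))) => //.
  by apply: dfn_sub dP _; vars.
exact: (covered_pull f cP).
Qed.

Lemma indep_inv X Y (a a' : X -> M) (b b' : Y -> M) : small K Y ->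
  eqt (a +++ b) (a' +++ b') -> indep a b -> indep a' b'.
Proof.
move=> sY E ab P dP Pab cP; apply: (ab P dP); first exact: (eqt_sym E).
by apply: covered_inv cP => //; apply: (eqt_sub (F := fun u => u \o inr) (eqt_sym E)); vars.
Qed.

(** Otherwise a formula in the type of [a] over [b] would imply a forking one. *)
Lemma indep_ext X Y Z (a : X -> M) (b : Y -> M) (c : Z -> M) :
  small K X -> small K Y -> small K Z -> indep a b ->
  exists a', eqt (a +++ b) (a' +++ b) /\ indep a' (b +++ c).
Proof.
move=> sX sY sZ ab.
pose J := [set Q : (X -> M) -> Prop | definable (A `|` range (b +++ c)) Q /\ covered Q].
have [||||||P Q dP Pab [_ cQ]|a' [Ea aJ]] := @realize_avoid _ _ _ hM A sA X Y (Y + Z) a b (b +++ c) J.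
- by [].
- by [].
- by sm.
- by move=> Q [].
- by split; [exact: dfn_False|exact: covered_False].
- by move=> Q Q' [dQ cQ] [dQ' cQ']; split; [exact: dfn_or|exact: covered_or].
- apply: contrapT => /forallNP H; apply: (ab P dP Pab).
  apply: covered_sub cQ => x Px; apply: contrapT => nQ; exact: (H x).
exists a'; split=> // P dP Pab cP; apply: (aJ (fun x => P (x +++ (b +++ c)))) Pab; split=> //.
by apply/dfn_param; exists P.
Qed.

(** Extension up to conjugation over [b], which keeps [a] and moves the new
    parameters. *)
Lemma indep_ext_param X Y Z (a : X -> M) (b : Y -> M) (c : Z -> M) :
  small K X -> small K Y -> small K Z -> indep a b ->
  exists c', eqt (b +++ c) (b +++ c') /\ indep a (b +++ c').
Proof.
move=> sX sY sZ ab; have [a' [E na']] := indep_ext c sX sY sZ ab.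
have [|c' E'] := eqt_extend hM sA c _ sZ (eqt_sym E); first by sm.
exists c'; split.
  by apply: (eqt_sub (F := fun u => (u \o inl \o inr) +++ (u \o inr)) E'); vars.
apply: (@indep_inv _ _ a' a (b +++ c)) => //; first by sm.
apply: (eqt_sub (F := fun u : (X + Y) + Z -> M => (u \o inl \o inl) +++ ((u \o inl \o inr) +++ (u \o inr))) E'); vars.
Qed.

(** A covering can be pulled back along any map of variables, hence transferred to
    the finitely many variables that occur in [P]. *)
Lemma indep_fin X Y (a : X -> M) (b : Y -> M) :
  (forall n (f : 'I_n -> X), indep (a \o f) b) -> indep a b.
Proof.
move=> H P dP Pab cP.
have dP' : definable A (fun u : Y + X -> M => P ((u \o inr) +++ (u \o inl))).
  by apply: dfn_sub dP _; vars.
have [n [f [g PE]]] := dfn_support dP'.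
apply: (H n f (fun u => P ((u \o inl \o g) +++ (u \o inr)))).
- by apply: dfn_sub dP _; vars.
- exact/(PE b a).
- exact: (covered_pull g cP).
Qed.

End Forking.

Section Bridge.
Variables (L : language) (K : Type) (M : structure L) (hM : monster K M).
Variables (A : set M) (sA : small_set K A).

Local Notation eqt := (eqt A).
Local Notation indisc := (indisc A).
Local Notation nul := (of_void M).
Local Notation indep := (indep A).

(** * Comparison with the syntactic notions *)

Lemma indiscernibleP d (I : orderType d) X (a : I -> X -> M) W (w : W -> M) :
  indiscernible (A `|` range w) a <-> indisc (fun i j : I => (i < j)%O) w a.
Proof. by split=> H n i j ii ij; apply/eqt_rangeP; exact: H. Qed.

Lemma range_nul : A `|` range nul = A.
Proof. by apply/seteqP; split=> [m [//|[[]]]|m]; left. Qed.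

Lemma indiscernible_natP X (a : nat -> X -> M) :
  indiscernible A a <-> indisc lt_nat nul a.
Proof. by rewrite -[in indiscernible A a]range_nul indiscernibleP. Qed.

Lemma dfn_sat V (phi : formula L V) : definable A (fun e => sat e phi).
Proof.
exists (rename inl phi); split.
  by move=> m H; have [v _] := fv_rename H.
by move=> e; rewrite /holds sat_rename.
Qed.

Lemma holds_inst X Y (phi : formula L (X + Y)) (b : Y -> M) x :
  holds x (inst phi b) <-> sat (x +++ b) phi.
Proof.
rewrite /holds sat_rename; suff -> : (x +++ id) \o
  (fun v : X + Y => match v with inl x => inl x | inr y => inr (b y) end) = x +++ b by [].
by apply/funext => -[].
Qed.

Lemma divides_covered X (phi : formula L (X + M)) :
  divides A phi -> covered A (fun x => holds x phi).
Proof.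
move=> [n [psi [b [-> [bs [bI bE bC]]]]]].
apply: (dividing_covered (psi := fun u => sat u psi) (e := b)); first exact: dfn_sat.
- have [N [f [fP fC]]] : exists N (f : 'I_N -> _), (forall i, [set inst psi (bs i) | i in [set: nat]] (f i)) /\
      ~ exists c, forall i, holds c (f i).
    move/existsNP: bC => [N /existsNP[f /not_implyP[fP fC]]].
    by exists N, f.
  have /choice[k kP] : forall i, exists k, inst psi (bs k) = f i.
    by move=> i; have [k _ E] := fP i; exists k.
  exists bs, (\max_i k i).+1; split.
  + exact/indiscernible_natP.
  + by move=> i; apply/eqtP; rewrite bE.
  move=> x; apply: contrapT => /forallNP H; apply: fC; exists x => i.
  rewrite -kP; apply/holds_inst.
  by have /contrapT := H (Ordinal (leq_bigmax i : (k i < (\max_i k i).+1)%N)).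
- by move=> x /holds_inst.
Qed.

Lemma formula_forks_covered X (phi : formula L (X + M)) :
  formula_forks A phi -> covered A (fun x => holds x phi).
Proof.
move=> [n [psi [psiD H]]]; apply: (covered_sub (Q' := fun x => exists i, holds x (psi i)) H).
elim: n psi psiD {H} => [|n IH] psi psiD.
  by apply: covered_sub (covered_False A X) => x [[]].
apply: covered_sub (covered_or hM sA (divides_covered (psiD ord0)) (IH _ (fun i => psiD (lift ord0 i)))).
by move=> x [i]; case: (unliftP ord0 i) => [j|] ->; [right; exists j|left].
Qed.

Lemma eqt_plug V W (a b : V -> M) (w : W -> M) :
  (forall i, A (w i)) -> eqt a b -> eqt (a +++ w) (b +++ w).
Proof. by move=> Aw ab P dP; apply: (ab (fun e => P (e +++ w))); exact: dfn_plug. Qed.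

(** For passing back to formulas without parameters, as the definitions of dividing
    and NIP require; [v0] receives the constants that do not occur. *)
Lemma dfn_formula V (v0 : V) (P : (V -> M) -> Prop) : definable A P ->
  exists n (alpha : 'I_n -> M) (psi : formula L (V + 'I_n)),
    (forall i, A (alpha i)) /\ forall e, P e <-> sat (e +++ alpha) psi.
Proof.
move=> dP.
have : definable (set0 `|` range (fun m : A => val m)) P.
  apply: dfn_mono dP => m Am; right; by exists (SigSub (mem_set Am)).
move=> /dfn_param[Q dQ PQ].
have [n [f [g QE]]] := dfn_support dQ.
have [phi [phi0 phiP]] : definable set0 (fun u : V + 'I_n -> M => Q ((u \o inl) +++ (u \o inr \o g))).
  by apply: dfn_sub dQ _; vars.
exists n, (fun i => val (f i)), (rename (fun v => match v with inl v => v | inr _ => inl v0 end) phi).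
split=> [i|e]; first exact/set_mem/valP.
rewrite PQ QE -[X in X <-> _](phiP (e +++ (fun i => val (f i)))) sat_rename.
by apply: sat_fv => -[//|m] /phi0.
Qed.

Lemma dividing_divides X m (psi : (X + 'I_m -> M) -> Prop) (e : 'I_m -> M) :
  definable A psi -> dividing A psi e ->
  exists phi, divides A phi /\ forall x, holds x phi <-> psi (x +++ e).
Proof.
move=> dpsi Dpsi; have [m0] := carrier_inhabited M.
(* The additional variable serves when there would be none at all. *)
pose e1 (i : 'I_m.+1) := if unlift ord0 i is Some j then e j else m0.
have E1 : e1 \o lift ord0 = e by apply/funext => i; rewrite /e1 /= liftK.
pose psi1 (u : X + 'I_m.+1 -> M) := psi ((u \o inl) +++ (u \o inr \o lift ord0)).
have dpsi1 : definable A psi1 by apply: dfn_sub dpsi _; vars.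
have [es [N [eI eE eN]]] : dividing A psi1 e1.
  by apply: dividing_lift; rewrite ?E1 //; sm.
have [n [al [phi [Aal phiP]]]] := dfn_formula (inr ord0) dpsi1.
pose J (c : 'I_m.+1 -> M) (i : 'I_(m.+1 + n)) : M :=
  match fintype.split i with inl k => c k | inr k => al k end.
pose s (u : (X + 'I_m.+1) + 'I_n) : X + 'I_(m.+1 + n) :=
  match u with inl (inl x) => inl x | inl (inr k) => inr (lshift n k) | inr k => inr (rshift _ k) end.
have sE x c : holds x (inst (rename s phi) (J c)) <-> psi1 (x +++ c).
  rewrite holds_inst sat_rename phiP; suff -> : (x +++ J c) \o s = x +++ c +++ al by [].
  apply/funext => -[[//|k]|k] /=; first by rewrite /J (unsplitK (inl k)).
  by rewrite /J (unsplitK (inr k)).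
exists (inst (rename s phi) (J e1)); split; last first.
  by move=> x; rewrite sE /psi1 -[in X in _ <-> X]E1.
exists (m.+1 + n)%N, (rename s phi), (J e1); split=> //.
exists (fun i => J (es i)); split.
- apply/indiscernible_natP => k i j ii ij.
  have /eqt_nul H := eI k i j ii ij.
  apply/eqt_nul; have := eqt_sub (F := fun v (u : 'I_k * 'I_(m.+1 + n)) =>
    match fintype.split u.2 with inl r => v (inl (u.1, r)) | inr r => v (inr r) end) (eqt_plug Aal H).
  apply=> -[r q] /=.
  by case: (fintype.split q) => t; [exists (inl (r, t))|exists (inr t)].
- move=> i; apply/eqtP; have := eqt_sub (F := fun v (u : 'I_(m.+1 + n)) =>
    match fintype.split u with inl r => v (inl r) | inr r => v (inr r) end)
    (eqt_plug Aal (eqt_sym (eE i))).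
  apply=> q /=.
  by case: (fintype.split q) => t; [exists (inl t)|exists (inr t)].
move=> /(_ N (fun i : 'I_N => inst (rename s phi) (J (es i)))) [i|c cP]; first by exists i.
by have [i] := eN c; apply; apply/sE.
Qed.

Lemma covered_formula_forks X (phi : formula L (X + M)) :
  covered A (fun x => holds x phi) -> formula_forks A phi.
Proof.
move=> [m [e [n [psi [H C]]]]].
have /choice[th thP] : forall j : 'I_n, exists phi, divides A phi /\ forall x, holds x phi <-> psi j (x +++ e).
  by move=> j; have [? ?] := H j (ltn_ord j); exact: dividing_divides.
exists n, th; split=> [j|x /C[j jn pj]]; first by case: (thP j).
by exists (Ordinal jn); apply/(thP _).2.
Qed.

Lemma forks_covered X (p : set (formula L (X + M))) : forks A p ->
  exists n (phi : 'I_n -> formula L (X + M)),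
    (forall i, p (phi i)) /\ covered A (fun x => forall i, holds x (phi i)).
Proof.
move=> [phi [[n [psi [pp H]]] /formula_forks_covered C]].
by exists n, psi; split=> //; apply: covered_sub C.
Qed.

Lemma nonforkingP X Y (a : X -> M) (b : Y -> M) : nonforking a A (range b) <-> indep a b.
Proof.
split=> [H P dP Pab cP|ab /forks_covered[n [phi [pp C]]]].
  have [phi [Bphi phiP]] : definable (A `|` range b) (fun x => P (x +++ b)).
    by apply/dfn_param; exists P.
  apply: H; exists phi; split.
    exists 1%N, (fun=> phi); split=> [i|c]; first by split=> //; apply/phiP.
    by apply; exact: ord0.
  by apply: covered_formula_forks; apply: covered_sub cP => x /phiP.
have /choice[Q QP] : forall i, exists Q, definable A Q /\ forall x, holds x (phi i) <-> Q (x +++ b).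
  move=> i; have [Bi _] := pp i.
  have [|Q dQ QE] := (@dfn_param _ _ A X Y b (fun x => holds x (phi i))).1; last by exists Q.
  by exists (phi i).
apply: (ab (fun u => forall i, Q i u)).
- by apply: dfn_ball => i; case: (QP i).
- by move=> i; apply/(QP i).2; case: (pp i).
- by apply: covered_sub C => x H i; apply/(QP i).2.
Qed.

(** * Consequences of left total triviality *)

Hypothesis (hA : extension_base K A) (hleft : left_totally_trivial K A).

Lemma indep_base X (a : X -> M) : small K X -> indep a nul.
Proof.
move=> sX; apply/nonforkingP; have := hA.2 X a sX.
by rewrite /nonforking range_nul setUid.
Qed.

Lemma indep_exists X Y (a : X -> M) (b : Y -> M) : small K X -> small K Y ->
  exists a', eqt a a' /\ indep a' b.
Proof.
move=> sX sY; have [a' [E na']] := indep_ext hM sA b sX (small_void hM) sY (indep_base (a := a) sX).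
exists a'; split; first exact/eqt_nul.
exact: (indep_sub (f := id) (g := inr) na').
Qed.

Lemma indep_nul Y (b : Y -> M) : small K Y -> indep nul b.
Proof.
move=> sY; have [c [_]] := indep_exists nul b (small_void hM) sY.
by suff -> : c = nul by []; apply/funext => -[].
Qed.

(** Triviality adds the entries one at a time, and finite character does the rest. *)
Lemma indep_elem X Y (a : X -> M) (b : Y -> M) : small K Y ->
  (forall x, indep (fun _ : unit => a x) b) -> indep a b.
Proof.
move=> sY H; apply: indep_fin => n f.
have {H} : forall i, indep (fun _ : unit => (a \o f) i) b by move=> i; exact: H.
move: (a \o f) => c {f}; elim: n c => [|n IH] c H.
  have f0 : 'I_0 -> void by case.
  have := indep_sub (f := f0) (g := id) (indep_nul (b := b) sY).
  by suff -> : nul \o f0 = c by []; apply/funext => -[].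
have : indep ((c \o lift ord0) +++ (fun _ : unit => c ord0)) b.
  apply/nonforkingP; apply: hleft; try sm; apply/nonforkingP; last exact: H.
  by apply: IH => i; exact: H.
move=> /(indep_sub (f := fun i => if unlift ord0 i is Some j then inl j else inr tt) (g := id)).
suff -> : ((c \o lift ord0) +++ (fun _ : unit => c ord0)) \o
  (fun i => if unlift ord0 i is Some j then inl j else inr tt) = c by [].
by apply/funext => i /=; case: (unliftP ord0 i) => [j|] ->.
Qed.

Lemma indep_cat X X' Y (a : X -> M) (a' : X' -> M) (b : Y -> M) : small K Y ->
  indep a b -> indep a' b -> indep (a +++ a') b.
Proof.
move=> sY ab a'b; apply: indep_elem => // -[x|x].
  exact: (indep_sub (f := fun=> x) (g := id) ab).
exact: (indep_sub (f := fun=> x) (g := id) a'b).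
Qed.

Lemma indep_seq J X Y (a : J -> X -> M) (b : Y -> M) : small K Y ->
  (forall j, indep (a j) b) -> indep (seq_tuple a) b.
Proof.
move=> sY H; apply: indep_elem => // -[j x].
exact: (indep_sub (f := fun=> x) (g := id) (H j)).
Qed.

End Bridge.

Section Indiscernible.
Variables (L : language) (K : Type) (M : structure L) (hM : monster K M).
Variables (A : set M) (sA : small_set K A).

Local Notation eqt := (eqt A).
Local Notation indisc := (indisc A).
Local Notation nul := (of_void M).
Local Notation indep := (indep A).
Local Notation dividing := (dividing A).
Local Notation covered := (covered A).

(** * Nonforking and indiscernible sequences *)

(** What [extract] transfers, in the case of single terms; [extract_pairs] treats
    pairs. *)
Lemma extract_terms I J (S : I -> I -> Prop) (R : J -> J -> Prop) Y W (w : W -> M)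
    (c : I -> Y -> M) (b : J -> Y -> M) :
  (forall n (P : ('I_n * Y + W -> M) -> Prop), definable A P ->
    (forall i : 'I_n -> I, incr S i -> P (seq_tuple (c \o i) +++ w)) ->
    forall j : 'I_n -> J, incr R j -> P (seq_tuple (b \o j) +++ w)) ->
  forall Q, definable A Q -> (forall i, Q (c i +++ w)) -> forall j, Q (b j +++ w).
Proof.
move=> EM Q dQ Qc j.
pose P (e : 'I_1 * Y + W -> M) := Q ((fun y => e (inl (ord0, y))) +++ (e \o inr)).
apply: (EM 1%N P _ _ (fun=> j)); first by apply: dfn_sub dQ _; vars.
  by move=> i _; exact: (Qc (i ord0)).
by move=> [[|//] ?] [[|//] ?].
Qed.

Lemma extract_pairs I J (S : I -> I -> Prop) (R : J -> J -> Prop) Y W (w : W -> M)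
    (c : I -> Y -> M) (b : J -> Y -> M) :
  (forall n (P : ('I_n * Y + W -> M) -> Prop), definable A P ->
    (forall i : 'I_n -> I, incr S i -> P (seq_tuple (c \o i) +++ w)) ->
    forall j : 'I_n -> J, incr R j -> P (seq_tuple (b \o j) +++ w)) ->
  forall Q, definable A Q -> (forall i k, S i k -> Q (c k +++ c i)) ->
  forall j k, R j k -> Q (b k +++ b j).
Proof.
move=> EM Q dQ Qc j k jk.
pose P (e : 'I_2 * Y + W -> M) := Q ((fun y => e (inl (ord_max, y))) +++ (fun y => e (inl (ord0, y)))).
apply: (EM 2%N P _ _ (fun r => if r == ord0 then j else k)); first by apply: dfn_sub dQ _; vars.
  by move=> i ii; exact: (Qc (i ord0) (i ord_max) (ii ord0 ord_max isT)).
by move=> [[|[|//]] ?] [[|[|//]] ?].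
Qed.

(** The type of [a] over the term [c j0] does not divide, so one tuple [x] realizes
    it over infinitely many terms; an extraction over [x] makes the sequence
    indiscernible, and a conjugation brings [x] back to [a]. *)
Lemma indep_move J (R : J -> J -> Prop) h X Y (a : X -> M) (c : J -> Y -> M) j0 :
  small K J -> small K X -> small K Y -> chain R h -> indisc R nul c -> indep a (c j0) ->
  exists c', [/\ indisc R a c', eqt (seq_tuple c) (seq_tuple c') & c' j0 = c j0].
Proof.
move=> sJ sX sY Rh cI ac; have [_ _ hR _] := Rh.
have cE i j : eqt (c i) (c j) by apply/eqt_nul; exact: indisc1 cI.
(* The conditions for a realization of the type of [a] along the sequence. *)
pose F := [set Q : (X -> M) -> Prop | exists Pn : ((X + Y -> M) -> Prop) * nat,
  [/\ definable A Pn.1, Pn.1 (a +++ c j0) & Q = fun x => Pn.1 (x +++ c (h Pn.2))]].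
have [||Q [[P n] [/= dP _ ->]]|n Q FQ|x xF] := @saturation _ _ _ hM A sA X (J * Y) (seq_tuple c) F.
- by [].
- by sm.
- apply/dfn_param; exists (fun u => P ((u \o inl) +++ (fun y => u (inr (h n, y))))) => //.
  by apply: dfn_sub dP _; vars.
- have /choice[Pn PnP] := FQ.
  pose P u := forall i, (Pn i).1 u.
  have dP : definable A P by apply: dfn_ball => i; case: (PnP i).
  have Pa : P (a +++ c j0) by move=> i; case: (PnP i).
  apply: contrapT => nx; apply: (ac P dP Pa).
  apply: (dividing_covered dP (e := c j0)) => //.
  exists (c \o h), (\max_i (Pn i).2).+1; split.
  + exact: indisc_reindex hR cI.
  + by move=> i; exact: cE.
  + move=> x; apply: contrapT => nH; apply: nx; exists x => i.
    have [_ _ ->] := PnP i; apply: contrapT => nPi; apply: nH.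
    by exists (Ordinal (leq_bigmax i : ((Pn i).2 < (\max_i (Pn i).2).+1)%N)) => /(_ i).
have xE n : eqt (a +++ c j0) (x +++ c (h n)).
  by move=> P dP Pa; apply: (xF (fun x => P (x +++ c (h n)))); exists (P, n).
have [b [bI bE]] := extract hM sA x (c \o h) sJ sY sX (chain_irr Rh) (chain_trans Rh).
have {}bE n (P : ('I_n * Y + X -> M) -> Prop) : definable A P ->
    (forall i : 'I_n -> nat, incr lt_nat i -> P (seq_tuple (c \o h \o i) +++ x)) ->
    forall j : 'I_n -> J, incr R j -> P (seq_tuple (b \o j) +++ x) by exact: bE.
have cb : eqt (seq_tuple c) (seq_tuple b).
  apply/eqt_nul; apply: (eqt_chain Rh) => n i ii; apply/eqt_nul => P dP Pi.
  apply: (bE n (fun e => P (e \o inl))) => //; first by apply: dfn_sub dP _; vars.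
  move=> j jj; have /eqt_nul H := cI n i (h \o j) ii (fun k l kl => hR _ _ (jj k l kl)).
  exact: H Pi.
have bxE j : eqt (c j0 +++ a) (b j +++ x).
  move=> P dP Pa; apply: (extract_terms (S := lt_nat) bE dP) => i.
  suff H : eqt (c j0 +++ a) (c (h i) +++ x) by exact: (H P dP Pa).
  by apply: (eqt_sub (F := fun u => (u \o inr) +++ (u \o inl)) (xE i)); vars.
have [|c' c'P] := eqt_extend hM sA (seq_tuple b) _ (small_prod hM sJ sY) (eqt_sym (bxE j0)); first by sm.
exists (fun j y => c' (j, y)).
have Ec' : seq_tuple (fun j y => c' (j, y)) = c' by apply/funext => -[].
split; rewrite ?Ec'.
- apply: indisc_inv bI; rewrite Ec'.
  by apply: (eqt_sub (F := fun u => (u \o inr) +++ (u \o inl \o inr)) c'P); vars.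
- apply: eqt_trans cb _.
  by apply: (eqt_sub (F := fun u => u \o inr) c'P); vars.
apply/funext => y; apply/esym.
by apply: (eqt_coord (v := inl (inl y)) (w := inr (j0, y)) c'P).
Qed.

(** Here the sequence is first conjugated so as to start at [e]. *)
Lemma indep_move_start X Y (a : X -> M) (e : Y -> M) (c : nat -> Y -> M) :
  small K X -> small K Y -> indisc lt_nat nul c -> eqt (c 0%N) e -> indep a e ->
  exists c', [/\ indisc lt_nat a c', eqt (seq_tuple c) (seq_tuple c') & c' 0%N = e].
Proof.
move=> sX sY cI ce ae.
have [|d dP] := eqt_extend hM sA (seq_tuple c) sY _ ce; first by sm.
pose c1 i y := d (i, y).
have E1 : seq_tuple c1 = d by apply/funext => -[].
have cc1 : eqt (seq_tuple c) (seq_tuple c1).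
  by rewrite E1; apply: (eqt_sub (F := fun u => u \o inr) dP); vars.
have c10 : c1 0%N = e.
  apply/funext => y; apply/esym.
  by apply: (eqt_coord (v := inl y) (w := inr (0%N, y)) dP).
have c1I : indisc lt_nat nul c1 by apply: indisc_inv cI; apply/eqt_nul.
have [|c' [c'I E c'0]] := indep_move (small_nat hM) sX sY chain_nat c1I (j0 := 0%N) (a := a).
  by rewrite c10.
exists c'; split=> //; first exact: eqt_trans E.
by rewrite c'0.
Qed.

(** * Consequences of NIP *)

Variables (T : theory L) (hMT : models M T) (hNIP : NIP T).

(** NIP for predicates with parameters in [A] and infinitely many variables; by
    saturation, it is enough to realize the patterns along finite parts of the
    sequence. *)
Lemma no_IP X Y (P : (X + Y -> M) -> Prop) (b : nat -> Y -> M) :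
  small K X -> small K Y -> definable A P ->
  ~ forall N (s : nat -> Prop), exists x, forall i : 'I_N, P (x +++ b i) <-> s i.
Proof.
move=> sX sY dP H.
have {}H (s : nat -> Prop) : exists x, forall i, P (x +++ b i) <-> s i.
  pose F := [set Q : (X -> M) -> Prop | exists i, Q = fun x => P (x +++ b i) <-> s i].
  have [||Q [i ->]|n Q FQ|x xF] := @saturation _ _ _ hM A sA X (nat * Y) (seq_tuple b) F.
  - by [].
  - by sm.
  - apply/dfn_param; exists (fun u => P ((u \o inl) +++ (fun y => u (inr (i, y)))) <-> s i) => //.
    by apply: dfn_iff; [apply: dfn_sub dP _; vars|exact: dfn_cst].
  - have /choice[k kP] := FQ.
    have [x xP] := H (\max_i k i).+1 s; exists x => i; rewrite kP.
    exact: (xP (Ordinal (leq_bigmax i : (k i < (\max_i k i).+1)%N))).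
  by exists x => i; apply: (xF (fun x => P (x +++ b i) <-> s i)); exists i.
(* Reduction to finitely many variables and no parameters. *)
have [q [f [g PE]]] := dfn_support dP.
have dP1 : definable A (fun u : 'I_q + X -> M => P ((u \o inr) +++ (u \o inl \o g))).
  by apply: dfn_sub dP _; vars.
have [p [f' [g' PE']]] := dfn_support dP1.
pose P2 (u : 'I_p.+1 + 'I_q -> M) := P ((u \o inl \o lift ord0 \o g') +++ (u \o inr \o g)).
have dP2 : definable A P2 by apply: dfn_sub dP _; vars.
have [k [al [phi [_ phiP]]]] := dfn_formula (inl ord0) dP2.
have /choice[x xP] := H.
have [m0] := carrier_inhabited M.
pose J s (i : 'I_(p.+1 + k)) : M := match fintype.split i with
  inl r => if unlift ord0 r is Some t then x s (f' t) else m0 | inr r => al r end.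
pose t (u : ('I_p.+1 + 'I_q) + 'I_k) : 'I_q + 'I_(p.+1 + k) :=
  match u with inl (inl r) => inr (lshift k r) | inl (inr r) => inl r | inr r => inr (rshift _ r) end.
apply: (hNIP hMT (phi := rename t phi)).
exists (fun i => b i \o f), J => i s; rewrite sat_rename.
pose xs (r : 'I_p.+1) := if unlift ord0 r is Some t then x s (f' t) else m0.
have -> : ((b i \o f) +++ J s) \o t = (xs +++ (b i \o f)) +++ al.
  apply/funext => -[[r|//]|r] /=; first by rewrite /J (unsplitK (inl r)).
  by rewrite /J (unsplitK (inr r)).
rewrite -phiP /P2 -[X in _ <-> X](xP s i) (PE (x s) (b i)) (PE' (b i \o f) (x s)).
suff -> : (xs +++ (b i \o f)) \o inl \o lift ord0 = x s \o f' by [].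
by apply/funext => r; rewrite /xs /= liftK.
Qed.

Lemma indisc_pairs Y W (w : W -> M) (c : nat -> Y -> M) :
  indisc lt_nat w c -> indisc lt_nat nul (fun n => (c n.*2 +++ c n.*2.+1) +++ w).
Proof.
move=> cI k i j ii jj.
have dbl (i0 : 'I_k -> nat) : incr lt_nat i0 ->
    exists i2 : 'I_k.*2 -> nat, incr lt_nat i2 /\
    forall r : 'I_k, forall l : 'I_k.*2, (l = r.*2 :> nat -> i2 l = (i0 r).*2) /\
      (l = r.*2.+1 :> nat -> i2 l = (i0 r).*2.+1).
  move=> i0i.
  have hl (l : 'I_k.*2) : (l./2 < k)%N by have := ltn_ord l; lia.
  exists (fun l => (i0 (Ordinal (hl l))).*2 + odd l)%N; split=> [l m lm|r l].
    have [E|ne] := eqVneq (l./2) (m./2).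
      have -> : Ordinal (hl l) = Ordinal (hl m) by apply: val_inj.
      by rewrite ltn_add2l; move: lm E; lia.
    have /= := i0i (Ordinal (hl l)) (Ordinal (hl m)).
    by move: lm ne; lia.
  split=> E.
    suff -> : Ordinal (hl l) = r by lia.
    by apply: val_inj => /=; lia.
  suff -> : Ordinal (hl l) = r by lia.
  by apply: val_inj => /=; lia.
have [i2 [i2i i2P]] := dbl i ii.
have [j2 [j2i j2P]] := dbl j jj.
have e0 (r : 'I_k) : (r.*2 < k.*2)%N by rewrite ltn_double.
have e1 (r : 'I_k) : (r.*2.+1 < k.*2)%N by have := ltn_ord r; lia.
pose F (v : 'I_k.*2 * Y + W -> M) (u : 'I_k * ((Y + Y) + W) + void) : M :=
  match u with inl (r, inl (inl y)) => v (inl (Ordinal (e0 r), y))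
  | inl (r, inl (inr y)) => v (inl (Ordinal (e1 r), y))
  | inl (r, inr z) => v (inr z) | inr o => of_void M o end.
have FE (i0 : 'I_k -> nat) (i3 : 'I_k.*2 -> nat) :
  (forall r : 'I_k, forall l : 'I_k.*2, (l = r.*2 :> nat -> i3 l = (i0 r).*2) /\
      (l = r.*2.+1 :> nat -> i3 l = (i0 r).*2.+1)) ->
  F (seq_tuple (c \o i3) +++ w) =
  (fun u => (c (i0 u.1).*2 +++ c (i0 u.1).*2.+1 +++ w) u.2) +++ nul.
  move=> i3P; apply/funext => -[[r [[y|y]|z]]|[]] //=; rewrite /seq_tuple /=.
    by rewrite ((i3P r (Ordinal (e0 r))).1 erefl).
  by rewrite ((i3P r (Ordinal (e1 r))).2 erefl).
rewrite -(FE _ _ i2P) -(FE _ _ j2P); apply: eqt_sub (cI _ _ _ i2i j2i) _.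
by move=> [[r [[y|y]|z]]|[]] /=; eexists; intro; reflexivity.
Qed.

Lemma indisc_comp Y W (w : W -> M) (c : nat -> Y -> M) h N : indisc lt_nat w c -> increasing h ->
  eqt (seq_tuple (fun i : 'I_N => c i) +++ w) (seq_tuple (fun i : 'I_N => c (h i)) +++ w).
Proof. by move=> cI hi; apply: (cI N (@nat_of_ord N) (fun i => h i)) => // k l; exact: hi. Qed.

(** If a formula in the type of [a] told two terms apart, then, as it does not
    divide, a single tuple would do so for arbitrarily many successive pairs of
    terms; choosing one term from each pair would produce all patterns along
    sequences of the type of [b], against NIP. *)
Lemma indep_same_type X Y W (a : X -> M) (w : W -> M) (b : nat -> Y -> M) i j :
  small K X -> small K Y -> small K W ->
  indisc lt_nat w b -> indep a (w +++ seq_tuple b) ->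
  eqt ((b i +++ w) +++ a) ((b j +++ w) +++ a).
Proof.
move=> sX sY sW bI ab.
suff main i0 j0 P : (i0 < j0)%N -> definable A P ->
    P ((b i0 +++ w) +++ a) -> ~ P ((b j0 +++ w) +++ a) -> False.
  have [ij|ji|->] := ltngtP i j; last exact: eqt_refl.
    by move=> P dP Pi; apply: contrapT => Pj; exact: (main _ _ _ ij dP).
  move=> P dP Pi; apply: contrapT => Pj.
  by apply: (main _ _ _ ji (dfn_not dP)) => //; exact.
move=> ij dP Pi Pj.
pose tau l := (if odd l then j0 + l./2 * j0.+1 else i0 + l./2 * j0.+1)%N.
have taui : increasing tau.
  apply: increasingS => l; rewrite /tau /= uphalf_half.
  by case: (odd l) => /=; rewrite ?add0n ?mulnDl; lia.
pose c := b \o tau.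
have cI : indisc lt_nat w c by apply: indisc_reindex bI; exact: taui.
have c0 : c 0%N = b i0 by rewrite /c /tau /= mul0n addn0.
have c1 : c 1%N = b j0 by rewrite /c /tau /= mul0n addn0.
pose es n := (c n.*2 +++ c n.*2.+1) +++ w.
have esI : indisc lt_nat nul es by exact: indisc_pairs.
pose psi (u : X + ((Y + Y) + W) -> M) :=
  P (((u \o inr \o inl \o inl) +++ (u \o inr \o inr)) +++ (u \o inl)) /\
  ~ P (((u \o inr \o inl \o inr) +++ (u \o inr \o inr)) +++ (u \o inl)).
have dpsi : definable A psi.
  by apply: dfn_and; [|apply: dfn_not]; apply: dfn_sub dP _; vars.
have ndiv : ~ dividing psi (es 0%N).
  move=> /(dividing_covered dpsi) D.
  have := indep_sub (f := id) (g := fun u => match u with inl (inl y) => inr (i0, y)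
     | inl (inr y) => inr (j0, y) | inr z => inl z end) ab.
  suff -> : (w +++ seq_tuple b) \o (fun u => match u with inl (inl y) => inr (i0, y)
     | inl (inr y) => inr (j0, y) | inr z => inl z end) = es 0%N.
    move=> /(_ psi dpsi); apply; last exact: D.
    suff H : P ((c 0%N +++ w) +++ a) /\ ~ P ((c 1%N +++ w) +++ a) by exact: H.
    by rewrite c0 c1.
  by rewrite /es /= c0 c1; apply/funext => -[[]|].
apply: (no_IP (P := fun u : X + (Y + W) -> M => P ((u \o inr) +++ (u \o inl)))
   (b := fun n => c n +++ w)) => //; first by sm.
  by apply: dfn_sub dP _; vars.
move=> N s.
have [x xP] : exists x, forall i : 'I_N, psi (x +++ es i).
  apply: contrapT => nx; apply: ndiv; exists es, N; split=> //.
    by move=> n; apply/eqt_nul; exact: indisc1 esI.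
  by move=> x; apply: contrapT => nH; apply: nx; exists x => i1; apply: contrapT => ?; apply: nH; exists i1.
pose h n := if `[< s n >] then n.*2 else n.*2.+1.
have hi : increasing h by apply: increasingS => n; rewrite /h; do 2!case: ifP => _; lia.
pose R (u : ('I_N * Y) + W -> M) := exists x, forall i : 'I_N,
  P (((fun y => u (inl (i, y))) +++ (u \o inr)) +++ x) <-> s i.
have dR : definable A R.
  apply: (dfn_ex (P := fun u : ('I_N * Y + W) + X -> M => forall i : 'I_N,
    P (((fun y => u (inl (inl (i, y)))) +++ (u \o inl \o inr)) +++ (u \o inr)) <-> s i)).
  apply: dfn_ball => i1; apply: dfn_iff; last exact: dfn_cst.
  by apply: dfn_sub dP _; vars.
suff : R (seq_tuple (fun i : 'I_N => c (h i)) +++ w).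
  by move=> /(eqt_sym (indisc_comp (N := N) cI hi) dR).
exists x => i1; rewrite /seq_tuple /= /h.
have [p1 p2] := xP i1.
by case: asboolP => si; split.
Qed.

End Indiscernible.

Section Arrays.
Variables (L : language) (K : Type) (M : structure L) (hM : monster K M).
Variables (A : set M) (sA : small_set K A).
Variables (T : theory L) (hMT : models M T) (hNIP : NIP T).

Local Notation eqt := (eqt A).
Local Notation indisc := (indisc A).
Local Notation nul := (of_void M).
Local Notation indep := (indep A).
Local Notation dividing := (dividing A).
Local Notation covered := (covered A).

(** * Arrays *)

(* The sequences [I i] are the rows of the array, and [I i 0] are their heads. *)
Section Array.
Variables (Y : Type) (I : nat -> nat -> Y -> M).

Definition rows_before i : 'I_i * (nat * Y) -> M :=
  seq_tuple (fun k : 'I_i => seq_tuple (I k)).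
Definition heads_after i : nat * Y -> M :=
  seq_tuple (fun k => I (i.+1 + k)%N 0%N).

Hypothesis rowI : forall i j,
  eqt ((I i j +++ rows_before (i := i)) +++ heads_after i)
      ((I i 0%N +++ rows_before (i := i)) +++ heads_after i).

(** Choices are undone row by row, the last row first, so that the later rows are
    already at their heads. *)
Lemma path_type N (eta : nat -> nat) :
  eqt (seq_tuple (fun k => I k (if (k < N)%N then eta k else 0%N)))
      (seq_tuple (fun k => I k 0%N)).
Proof.
elim: N => [|N IH]; first by exact: eqt_refl.
apply: eqt_trans IH.
pose F (u : (Y + 'I_N * (nat * Y)) + nat * Y -> M) (p : nat * Y) : M :=
  if insub p.1 is Some k then u (inl (inr (k, (eta p.1, p.2))))
  else if p.1 == N then u (inl (inl p.2)) else u (inr ((p.1 - N.+1)%N, p.2)).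
have FE j : F ((I N j +++ rows_before (i := N)) +++ heads_after N) =
  seq_tuple (fun k => I k (if (k < N)%N then eta k else if k == N then j else 0%N)).
  apply/funext => -[k y]; rewrite /F /seq_tuple /=.
  case: insubP => [k' kN k'k|]; first by rewrite kN /= /rows_before /seq_tuple /= k'k.
  rewrite -leqNgt leq_eqVlt => /predU1P[<-|Nk]; first by rewrite ltnn !eqxx.
  rewrite ltnNge (ltnW Nk) /= gtn_eqF //= /heads_after /seq_tuple /= subnKC //.
have E1 : (fun k => I k (if (k < N.+1)%N then eta k else 0%N)) =
    (fun k => I k (if (k < N)%N then eta k else if k == N then eta N else 0%N)).
  by apply/funext => k; rewrite ltnS; case: ltngtP => // ->.
have E2 : (fun k => I k (if (k < N)%N then eta k else 0%N)) =
    (fun k => I k (if (k < N)%N then eta k else if k == N then 0%N else 0%N)).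
  by apply/funext => k; case: ifP => // _; case: ifP.
rewrite E1 E2 -(FE (eta N)) -(FE 0%N). apply: (eqt_sub (F := F) (@rowI N (eta N))) => -[k y]; rewrite /F /=.
case: (insub k) => [k'|]; first by exists (inl (inr (k', (eta k, y)))).
by case: (k == N); [exists (inl (inl y))|exists (inr ((k - N.+1)%N, y))].
Qed.

(** A realization along the heads fails somewhere in each row. Moving to such
    entries in the rows outside [s] gives a path along which it realizes the
    pattern [s], and all paths have the same type. *)
Lemma array_patterns X (psi : (X + Y -> M) -> Prop) N (k : 'I_N -> nat) (s : nat -> Prop) :
  definable A psi -> (forall i x, exists j, ~ psi (x +++ I i j)) ->
  injective k ->
  (exists x, forall r, psi (x +++ I (k r) 0%N)) ->
  exists x, forall r, psi (x +++ I (k r) 0%N) <-> s (k r).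
Proof.
move=> dpsi rows kinj [x xP].
have /choice[j jP] := fun i => rows i x.
pose eta n := if `[< s n >] then 0%N else j n.
pose R (u : nat * Y -> M) := exists x, forall r, psi (x +++ (fun y => u (k r, y))) <-> s (k r).
have dR : definable A R.
  apply: (dfn_ex (P := fun u : nat * Y + X -> M =>
     forall r, psi ((u \o inr) +++ (fun y => u (inl (k r, y)))) <-> s (k r))).
  by apply: dfn_ball => r; apply: dfn_iff; [apply: dfn_sub dpsi _; vars|exact: dfn_cst].
apply: (@path_type (\max_r k r).+1 eta R dR); exists x => r.
rewrite /seq_tuple /= ltnS (leq_bigmax r) /eta.
case: asboolP => sk; first by split=> // _; exact: xP.
by split=> // H; case: (jP (k r) H).
Qed.

End Array.

Lemma no_all_patterns X Y (psi : (X + Y -> M) -> Prop) (c : nat -> Y -> M) :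
  small K X -> small K Y -> definable A psi ->
  (forall N (s : nat -> Prop), (exists x, forall i : 'I_N, psi (x +++ c i)) ->
     exists x, forall i : 'I_N, psi (x +++ c i) <-> s i) ->
  exists N, inconsistent_along psi N c.
Proof.
move=> sX sY dpsi H; apply: contrapT => /forallNP nN.
apply: (no_IP hM sA hMT hNIP (b := c) sX sY dpsi) => N s; apply: H.
apply: contrapT => nx; apply: (nN N) => x.
by apply: contrapT => nH; apply: nx; exists x => i; apply: contrapT => ?; apply: nH; exists i.
Qed.

(** * Dividing along independent sequences *)

Variables (hA : extension_base K A) (hleft : left_totally_trivial K A).

(** The rows of an array are copies of a dividing sequence, each indiscernible over
    the earlier ones and with terms independent from them. By [indep_same_type],
    hence by NIP, all paths have the same type, and by NIP again [psi] cannot be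
    satisfied along the heads; the sequence [c] is extracted from the latter. *)
Lemma dividing_independent X Y (psi : (X + Y -> M) -> Prop) (e : Y -> M) :
  small K X -> small K Y -> definable A psi -> dividing psi e ->
  exists c N, [/\ indisc lt_nat nul c, forall i, eqt e (c i),
    forall i j, (i < j)%N -> indep (c j) (c i) & inconsistent_along psi N c].
Proof.
move=> sX sY dpsi [es [N [esI esE esN]]].
pose R n (h : nat -> nat -> Y -> M) (t : nat -> Y -> M) :=
  [/\ eqt (seq_tuple es) (seq_tuple t), indisc lt_nat (rows_before h (i := n)) t &
      forall j, indep (t j) (rows_before h (i := n))].
have [||I IP] := @dependent_choice _ es R.
- move=> n h h' t hh'; rewrite /R; suff -> : rows_before h (i := n) = rows_before h' (i := n) by [].
  by apply/funext => -[k p]; rewrite /rows_before /seq_tuple /= hh'.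
- move=> n h _; pose w := rows_before h (i := n).
  have sw : small K ('I_n * (nat * Y)) by sm.
  have [t0 [Et0 nt0]] := indep_exists hM sA hA (seq_tuple es) w (small_prod hM (small_nat hM) sY) sw.
  pose t1 j y := t0 (j, y).
  have Et1 : seq_tuple t1 = t0 by apply/funext => -[].
  have t1I : indisc lt_nat nul t1 by apply: indisc_inv esI; apply/eqt_nul; rewrite Et1.
  have [b [bI bE bEM]] := extract_like hM sA w (small_nat hM) sY sw chain_nat t1I.
  exists b; split=> //; first by apply: eqt_trans bE; rewrite Et1.
  move=> j P dP Pj cP.
  apply: (extract_terms (S := lt_nat) (R := lt_nat) bEM (dfn_not dP) _ j Pj) => i Pi.
  have := indep_sub (f := fun y => (i, y)) (g := id) nt0.
  by move=> /(_ P dP Pi); apply.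
have IE i : eqt (seq_tuple es) (seq_tuple (I i)) by case: (IP i).
have IEj i j : eqt e (I i j).
  apply: eqt_trans (esE j) _; apply: (eqt_sub (F := fun u y => u (j, y)) (IE i)); vars.
have rowI i j : eqt ((I i j +++ rows_before I (i := i)) +++ heads_after I i)
      ((I i 0%N +++ rows_before I (i := i)) +++ heads_after I i).
  have [_ iI _] := IP i; apply: (indep_same_type hM sA hMT hNIP) iI _; try sm.
  apply: (indep_seq hM sA hA hleft); first by sm.
  move=> k; have [_ _ nk] := IP (i.+1 + k)%N.
  have lt1 (r : 'I_i) : (r < i.+1 + k)%N by have := ltn_ord r; lia.
  have lt2 : (i < i.+1 + k)%N by lia.
  pose g (u : 'I_i * (nat * Y) + nat * Y) : 'I_(i.+1 + k) * (nat * Y) :=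
    match u with inl (r, p) => (Ordinal (lt1 r), p) | inr p => (Ordinal lt2, p) end.
  have := indep_sub (f := id) (g := g) (nk 0%N).
  suff -> : rows_before I (i := i.+1 + k) \o g = rows_before I (i := i) +++ seq_tuple (I i) by [].
  by apply/funext => -[[r p]|p].
have rows i x : exists j, ~ psi (x +++ I i j).
  by have [j] := inconsistent_eqt dpsi (IE i) esN x; exists j.
have heads i k : (i < k)%N -> indep (I k 0%N) (I i 0%N).
  move=> ik; have [_ _ nk] := IP k.
  exact: (indep_sub (f := id) (g := fun y => (Ordinal ik, (0%N, y))) (nk 0%N)).
have [c [cI cEM]] := extract hM sA nul (fun n => I n 0%N) (small_nat hM) sY (small_void hM)
  (chain_irr chain_nat) (chain_trans chain_nat).
have cE i : eqt e (c i).
  move=> P dP Pe; apply: (extract_terms (c := fun n => I n 0%N) (S := lt_nat) (R := lt_nat) (Q := fun u => P (u \o inl)) cEM).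
    by apply: dfn_sub dP _; vars.
  by move=> k; exact: (IEj k 0%N P dP Pe).
have [|N' cN] := @no_all_patterns X Y psi c sX sY dpsi; last first.
  exists c, N'; split=> // i k ik P dP Pik cP.
  have cP' m : covered (fun x => P (x +++ I m 0%N)).
    apply: (covered_inv hM sA sY dP _ cP); exact: eqt_trans (eqt_sym (cE i)) (IEj m 0%N).
  apply: (extract_pairs (b := c) (c := fun n => I n 0%N) (S := lt_nat) (R := lt_nat) cEM (dfn_not dP) _ ik Pik) => m m' mm' Pm.
  exact: (heads m m' mm' P dP Pm (cP' m)).
move=> n s xP.
pose Q1 (u : 'I_n * Y + void -> M) := exists x, forall i : 'I_n, psi (x +++ (fun y => u (inl (i, y)))).
pose Q2 (u : 'I_n * Y + void -> M) :=
  exists x, forall i : 'I_n, psi (x +++ (fun y => u (inl (i, y)))) <-> s i.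
have dQ : definable A (fun u => Q1 u -> Q2 u).
  apply: dfn_imp.
    apply: (dfn_ex (P := fun u : ('I_n * Y + void) + X -> M =>
       forall i, psi ((u \o inr) +++ (fun y => u (inl (inl (i, y))))))).
    by apply: dfn_ball => i; apply: dfn_sub dpsi _; vars.
  apply: (dfn_ex (P := fun u : ('I_n * Y + void) + X -> M =>
     forall i : 'I_n, psi ((u \o inr) +++ (fun y => u (inl (inl (i, y))))) <-> s i)).
  by apply: dfn_ball => i; apply: dfn_iff; [apply: dfn_sub dpsi _; vars|exact: dfn_cst].
apply: (cEM n _ dQ _ (@nat_of_ord n)) => // i ii [x Hx].
pose s' m := exists2 r : 'I_n, i r = m & s r.
have iinj : injective i.
  move=> r r' irr; apply: val_inj; apply/eqP; case: ltngtP => // [/ii|/ii].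
    by rewrite irr ltnn.
  by rewrite irr ltnn.
have [|x' x'P] := array_patterns rowI s' dpsi rows iinj; first by exists x.
exists x' => r; split=> [/x'P[r' /iinj ->//]|sr].
by apply/x'P; exists r.
Qed.

End Arrays.

Section Consequences.
Variables (L : language) (K : Type) (M : structure L) (hM : monster K M).
Variables (A : set M) (sA : small_set K A).
Variables (T : theory L) (hMT : models M T) (hNIP : NIP T).

Local Notation eqt := (eqt A).
Local Notation indisc := (indisc A).
Local Notation nul := (of_void M).
Local Notation indep := (indep A).
Local Notation dividing := (dividing A).
Local Notation covered := (covered A).

Variables (hA : extension_base K A) (hleft : left_totally_trivial K A).

(** * Eliminating dividing formulas *)

Section Elimination.
Variables (X Z : Type) (Xi : (X + Z -> M) -> Prop) (z : Z -> M).

(** The filter generated by the [A]-conjugates of [Xi(x,z)]. *)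
Definition conj_filter (Th : (X -> M) -> Prop) := exists m (es : 'I_m -> Z -> M),
  (forall s, eqt z (es s)) /\ forall x, (forall s, Xi (x +++ es s)) -> Th x.

Lemma conj_filter_sub (P Q : (X -> M) -> Prop) :
  (forall x, P x -> Q x) -> conj_filter P -> conj_filter Q.
Proof. by move=> PQ [m [es [E H]]]; exists m, es; split=> // x /H /PQ. Qed.

Lemma conj_filterI (P Q : (X -> M) -> Prop) :
  conj_filter P -> conj_filter Q -> conj_filter (fun x => P x /\ Q x).
Proof.
move=> [m1 [e1 [E1 H1]]] [m2 [e2 [E2 H2]]].
exists (m1 + m2)%N, (fun i => match fintype.split i with inl k => e1 k | inr k => e2 k end).
split=> [s|x H]; first by case: (fintype.split s).
split; [apply: H1 => s; have := H (lshift m2 s)|apply: H2 => s; have := H (rshift m1 s)].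
  by rewrite (unsplitK (inl s)).
by rewrite (unsplitK (inr s)).
Qed.

Lemma conj_filter_ball N (P : nat -> (X -> M) -> Prop) :
  (forall i, (i < N)%N -> conj_filter (P i)) -> conj_filter (fun x => forall i, (i < N)%N -> P i x).
Proof.
elim: N => [|N IH] H.
  have e0 : 'I_0 -> Z -> M by case.
  by exists 0%N, e0; split=> // -[].
have H1 := conj_filterI (IH (fun i iN => H i (ltnW iN))) (H N (ltnSn N)).
by apply: conj_filter_sub H1 => x [H2 H3] i; rewrite ltnS leq_eqVlt => /predU1P[->|/H2].
Qed.

Lemma conj_filter_inv U (d d' : U -> M) (Th : (X + U -> M) -> Prop) :
  small K U -> small K Z -> definable A Xi -> definable A Th -> eqt d d' ->
  conj_filter (fun x => Th (x +++ d)) -> conj_filter (fun x => Th (x +++ d')).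
Proof.
move=> sU sZ dXi dTh dd' [m [es [E H]]].
have [|es' E'] := eqt_extend hM sA (seq_tuple es) sU _ dd'; first by sm.
exists m, (fun i y => es' (i, y)); split=> [s|x].
  apply: eqt_trans (E s) _.
  by apply: (eqt_sub (F := fun u y => u (inr (s, y))) E'); vars.
pose R (u : U + 'I_m * Z -> M) := forall x,
  (forall s : 'I_m, Xi (x +++ (fun y => u (inr (s, y))))) -> Th (x +++ (u \o inl)).
have dR : definable A R.
  apply: (dfn_all (P := fun u : (U + 'I_m * Z) + X -> M =>
    (forall s : 'I_m, Xi ((u \o inr) +++ (fun y => u (inl (inr (s, y)))))) ->
      Th ((u \o inr) +++ (u \o inl \o inl)))).
  by apply: dfn_imp; [apply: dfn_ball => s; apply: dfn_sub dXi _|apply: dfn_sub dTh _]; vars.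
exact: (E' R dR H).
Qed.

(** By induction on the number of dividing formulas. The last one is removed along a
    sequence from [dividing_independent], moved to be indiscernible over [d]: the
    conjugates of the given disjunction along it are in the filter, and on the
    intersection of finitely many of them the last formula can be dropped, at the
    cost of having the others for each term of the sequence. By triviality, [d]
    together with the later terms is independent from each term, so the induction
    hypothesis removes the terms one after the other. *)
Lemma eliminate_dividing n (psi : nat -> (X + Z -> M) -> Prop) :
  small K X -> small K Z -> definable A Xi ->
  (forall j, (j < n)%N -> definable A (psi j) /\ dividing (psi j) z) ->
  forall U (d : U -> M) (Th : (X + U -> M) -> Prop) (e : Z -> M),
  small K U -> definable A Th -> eqt z e -> indep d e ->
  conj_filter (fun x => Th (x +++ d) \/ exists j : 'I_n, psi j (x +++ e)) ->
  conj_filter (fun x => Th (x +++ d)).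
Proof.
move=> sX sZ dXi; elim: n => [|n IH] Hpsi U d Th e sU dTh ze de H.
  by apply: conj_filter_sub H => x [//|[[]]].
have Hn j : (j < n)%N -> definable A (psi j) /\ dividing (psi j) z.
  by move=> jn; apply: Hpsi; exact: ltnW.
have dpsi (j : 'I_n.+1) : definable A (psi j) by case: (Hpsi j (ltn_ord j)).
have [dn Dn] := Hpsi n (ltnSn n).
have [c0 [N [c0I c0E c0nf c0N]]] := dividing_independent hM sA hMT hNIP hA hleft sX sZ dn Dn.
have [c [cI cc c0e]] := indep_move_start hM sA sU sZ c0I (eqt_trans (eqt_sym (c0E 0%N)) ze) de.
have ecE l : eqt (d +++ e) (d +++ c l).
  have := indisc1 (i := 0%N) l cI; rewrite c0e => E1.
  by apply: (eqt_sub (F := fun u => (u \o inr) +++ (u \o inl)) E1); vars.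
have cE l : eqt z (c l).
  apply: eqt_trans ze _; apply: (eqt_sub (F := fun u => u \o inr) (ecE l)); vars.
have cnf i j : (i < j)%N -> indep (c j) (c i).
  move=> /c0nf; apply: (indep_inv hM sA) => //.
  by apply: (eqt_sub (F := fun u => (fun y => u (j, y)) +++ (fun y => u (i, y))) cc); vars.
have cN : inconsistent_along (psi n) N c by exact: inconsistent_eqt dn cc c0N.
pose rest k x := exists l, [/\ (k <= l)%N, (l < N)%N & exists j : 'I_n, psi j (x +++ c l)].
have H0 : conj_filter (fun x => Th (x +++ d) \/ rest 0%N x).
  have Hl l : (l < N)%N -> conj_filter (fun x => Th (x +++ d) \/ exists j : 'I_n.+1, psi j (x +++ c l)).
    move=> _; apply: (@conj_filter_inv _ (d +++ e) (d +++ c l)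
      (fun u => Th ((u \o inl) +++ (u \o inr \o inl)) \/
                exists j : 'I_n.+1, psi j ((u \o inl) +++ (u \o inr \o inr)))) => //; first by sm.
    apply: dfn_or; first by apply: dfn_sub dTh _; vars.
    by apply: dfn_bex => j; apply: dfn_sub (dpsi j) _; vars.
  apply: conj_filter_sub (conj_filter_ball Hl) => x Hx.
  have [i ni] := cN x; have [|[j pj]] := Hx i (ltn_ord i); first by left.
  right; exists i; split=> //; have jn : (j < n)%N.
    by rewrite ltn_neqAle -ltnS ltn_ord andbT; apply/eqP => E; apply: ni; rewrite -E.
  by exists (Ordinal jn).
suff main k : (k <= N)%N -> conj_filter (fun x => Th (x +++ d) \/ rest k x).
  apply: conj_filter_sub (main N (leqnn N)) => x [//|[l [Nl lN _]]].
  by have := leq_trans lN Nl; rewrite ltnn.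
elim: k => [//|k IHk] kN.
pose d1 := d +++ seq_tuple (fun r => c (k.+1 + r)%N).
pose Th1 (u : X + (U + nat * Z) -> M) := Th ((u \o inl) +++ (u \o inr \o inl)) \/
  exists r : 'I_(N - k.+1), exists j : 'I_n, psi j ((u \o inl) +++ (fun y => u (inr (inr (nat_of_ord r, y))))).
have dTh1 : definable A Th1.
  apply: dfn_or; first by apply: dfn_sub dTh _; vars.
  apply: dfn_bex => r; apply: dfn_bex => j.
  by apply: dfn_sub (Hn j (ltn_ord j)).1 _; vars.
have Th1E x : Th1 (x +++ d1) <-> Th (x +++ d) \/ rest k.+1 x.
  split=> [[?|[r [j pj]]]|[?|[l [kl lN [j pj]]]]]; [by left| |by left|].
    right; exists (k.+1 + r)%N; split; [exact: leq_addr| |by exists j].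
    by have := ltn_ord r; lia.
  have lN' : (l - k.+1 < N - k.+1)%N by lia.
  right; exists (Ordinal lN'), j => /=.
  by rewrite /d1 /seq_tuple /= subnKC.
have := IH Hn _ d1 Th1 (c k); move=> /(_ _ dTh1 (cE k)) IH1.
apply: conj_filter_sub (IH1 _ _ _); first by move=> x /Th1E.
- by sm.
- apply: (indep_cat hM sA hA hleft) => //.
    by apply: (indep_inv hM sA) de => //; exact: ecE.
  apply: (indep_seq hM sA hA hleft) => // r; apply: cnf; lia.
apply: conj_filter_sub (IHk (ltnW kN)) => x [?|[l [kl lN [j pj]]]].
  by left; apply/Th1E; left.
have [E|kl'] := eqVneq k l; first by right; exists j; rewrite E.
left; apply/Th1E; right; exists l; split=> //; last by exists j.
by rewrite ltn_neqAle kl'.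
Qed.

End Elimination.

(** * Extension on the left, strict pairs *)

(** Otherwise a formula over [A] and [a] would imply a disjunction of dividing
    formulas, which can be eliminated over [a]. *)
Lemma indep_left_ext X Y V (a : X -> M) (b : Y -> M) (c : V -> M) :
  small K X -> small K Y -> small K V -> indep a b ->
  exists c', eqt (a +++ c) (a +++ c') /\ indep c' b.
Proof.
move=> sX sY sV ab.
pose J := [set Q : (V -> M) -> Prop | definable (A `|` range b) Q /\ covered Q].
have [|||||||c' [Ec cJ]] := @realize_avoid _ _ _ hM A sA V X Y c a b J.
- by [].
- by [].
- by [].
- by move=> Q [].
- by split; [exact: dfn_False|exact: covered_False].
- by move=> Q Q' [dQ cQ] [dQ' cQ']; split; [exact: dfn_or|exact: (covered_or hM sA)].
- move=> P Q dP Pca [/dfn_param[Q0 dQ0 QE] [m [z [n [psi [Hpsi C]]]]]].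
  apply: contrapT => /forallNP nx.
  have [z' [bz nz]] := indep_ext_param hM sA z sX sY (small_ord hM m) ab.
  have C' x : Q x -> exists j : 'I_n, psi j (x +++ z').
    have C0 y : Q0 (y +++ b) -> exists2 j, (j < n)%N & psi j (y +++ z) by move=> /QE /C.
    move=> /QE /(bz _ (dfn_covering dQ0 (fun j jn => (Hpsi j jn).1)) C0 x)[j jn pj].
    by exists (Ordinal jn).
  have [||||||||m' [es [_ H]]] := @eliminate_dividing V 'I_m (fun=> True) z n psi _ _ _ Hpsi X a (fun u => ~ P u) z'.
  + by [].
  + by sm.
  + exact: dfn_cst.
  + by [].
  + exact: dfn_not.
  + by apply: (eqt_sub (F := fun u => u \o inr) bz); vars.
  + exact: (indep_sub (f := id) (g := inr) nz).
  + have e0 : 'I_0 -> 'I_m -> M by case.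
    exists 0%N, e0; split=> [[//]|x _]; have [Px|] := pselect (P (x +++ a)); last by left.
    right; apply: C'; apply: contrapT => nQ; exact: (nx x).
  by apply: (H c) => // s.
exists c'; split; first by apply: (eqt_sub (F := fun u => (u \o inr) +++ (u \o inl)) Ec); vars.
move=> P dP Pc cP; apply: (cJ (fun x => P (x +++ b))) Pc; split=> //.
by apply/dfn_param; exists P.
Qed.

(** The formulas over [w] that a conjugate of [a] has to avoid in order to be
    independent from [w], and [w] from it. *)
Definition two_sided X W (a : X -> M) (w : W -> M) := [set Q : (X -> M) -> Prop |
  exists phi chi, [/\ definable A phi, definable A chi, covered (fun x => phi (x +++ w)),
    covered (fun y => chi (a +++ y)) & Q = fun x => phi (x +++ w) \/ chi (x +++ w)]].

Lemma realize_two_sided X Y W (a : X -> M) (b : Y -> M) (w : W -> M) :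
  small K X -> small K Y -> small K W ->
  (forall P phi chi, definable A P -> definable A phi -> definable A chi ->
    P (a +++ b) -> covered (fun x => phi (x +++ w)) -> covered (fun y => chi (a +++ y)) ->
    (forall x, P (x +++ b) -> phi (x +++ w) \/ chi (x +++ w)) -> False) ->
  exists a', [/\ eqt (a +++ b) (a' +++ b), indep a' w & indep w a'].
Proof.
move=> sX sY sW H.
have [|||||||a' [Ea aJ]] := @realize_avoid _ _ _ hM A sA X Y W a b w (two_sided a w).
- by [].
- by [].
- by [].
- move=> Q [phi [chi [dphi dchi _ _ ->]]]; apply/dfn_param.
  by exists (fun u => phi u \/ chi u) => //; exact: dfn_or.
- exists (fun=> False), (fun=> False); split; try exact: dfn_False; try exact: covered_False.
  by apply/funext => x; apply/propext; split=> // -[].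
- move=> Q Q' [p1 [c1 [dp1 dc1 Cp1 Cc1 ->]]] [p2 [c2 [dp2 dc2 Cp2 Cc2 ->]]].
  exists (fun u => p1 u \/ p2 u), (fun u => c1 u \/ c2 u); split; try exact: dfn_or.
  + exact: (covered_or hM sA) Cp1 Cp2.
  + exact: (covered_or hM sA) Cc1 Cc2.
  by apply/funext => x; apply/propext; tauto.
- move=> P Q dP Pab [phi [chi [dphi dchi Cphi Cchi ->]]].
  apply: contrapT => /forallNP nx; apply: (H P phi chi) => // x Px.
  by apply: contrapT => nQ; exact: (nx x).
exists a'; split=> // P dP Paw cP.
  apply: (aJ (fun x => P (x +++ w) \/ False)); last by left.
  exists P, (fun=> False); split=> //; [exact: dfn_False|exact: covered_False].
have dP' : definable A (fun u : X + W -> M => P ((u \o inr) +++ (u \o inl))).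
  by apply: dfn_sub dP _; vars.
apply: (aJ (fun x => False \/ P (w +++ x))); last by right.
exists (fun=> False), (fun u => P ((u \o inr) +++ (u \o inl))); split=> //.
- exact: dfn_False.
- exact: covered_False.
apply: (covered_inv hM sA sX dP) cP.
by apply: eqt_sym; apply: (eqt_sub (F := fun u => u \o inl) Ea); vars.
Qed.

(** Otherwise a formula [P] in the type of [b] implies [phi] or [chi], where
    [phi(x,w)] and [chi(b,y)] fork. Eliminating [phi], [P] implies the disjunction
    of [chi(x,w')] over finitely many conjugates [w'] of [w]. These have conjugates
    that are independent from [b], hence cannot satisfy [chi(b,y)]. *)
Lemma strict_pair X W (b : X -> M) (w : W -> M) : small K X -> small K W ->
  exists b', [/\ eqt b b', indep b' w & indep w b'].
Proof.
move=> sX sW.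
have [|b' [E n1 n2]] := @realize_two_sided X void W b nul w sX (small_void hM) sW; last first.
  by exists b'; split=> //; exact/eqt_nul.
move=> P phi chi dP dphi dchi Pb [m [z [n [psi [Hpsi C]]]]] Cchi H.
pose e := w +++ z.
pose psi' j (u : X + (W + 'I_m) -> M) := psi j ((u \o inl) +++ (u \o inr \o inr)).
pose Xi (u : X + (W + 'I_m) -> M) :=
  P ((u \o inl) +++ (fun v : void => of_void M v)) /\ ~ chi ((u \o inl) +++ (u \o inr \o inl)).
have dXi : definable A Xi.
  by apply: dfn_and; [apply: dfn_sub dP _|apply: dfn_not; apply: dfn_sub dchi _]; vars.
have Hpsi' j : (j < n)%N -> definable A (psi' j) /\ dividing (psi' j) e.
  move=> jn; have [dj Dj] := Hpsi j jn; split; first by apply: dfn_sub dj _; vars.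
  by apply: dividing_lift => //; sm.
have [|||||||k [es [esE esH]]] := @eliminate_dividing X (W + 'I_m)%type Xi e n psi' _ _ dXi Hpsi' void nul (fun=> False) e.
- by [].
- by sm.
- by sm.
- exact: dfn_False.
- exact: eqt_refl.
- by apply: (indep_nul hM sA hA); sm.
- exists 1%N, (fun=> e); split=> [s|x /(_ ord0) [Px nchi]]; first exact: eqt_refl.
  right; have [/C[j jn pj]|//] := H x Px; by exists (Ordinal jn).
have [|W' [EW nW]] := indep_exists hM sA hA (seq_tuple (fun s => es s \o inl)) b _ sX; first by sm.
pose R (u : 'I_k * W -> M) := forall x : X -> M, P (x +++ nul) ->
  exists s : 'I_k, chi (x +++ (fun y => u (s, y))).
have dR : definable A R.
  apply: (dfn_all (P := fun u : ('I_k * W) + X -> M => P ((u \o inr) +++ nul) ->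
    exists s : 'I_k, chi ((u \o inr) +++ (fun y => u (inl (s, y)))))).
  by apply: dfn_imp; [apply: dfn_sub dP _|apply: dfn_bex => s; apply: dfn_sub dchi _]; vars.
have RW : R (seq_tuple (fun s => es s \o inl)).
  move=> x Px; apply: contrapT => /forallNP ns; apply: (esH x) => s; split=> //.
  exact: (ns s).
have [s chis] := EW R dR RW b Pb.
have := indep_sub (f := fun y => (s, y)) (g := id) nW.
move=> /(_ (fun u => chi ((u \o inr) +++ (u \o inl)))); apply => //.
by apply: dfn_sub dchi _; vars.
Qed.

(** * Forking and dividing *)

Definition strict_seq Y (c : nat -> Y -> M) :=
  forall i j, i <> j -> indep (c i) (c j).

(** By [strict_pair], each term can be chosen independent from the earlier ones on
    both sides; pairwise independence survives the extraction. *)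
Lemma strict_seq_exists Y (e : Y -> M) : small K Y ->
  exists c, [/\ indisc lt_nat nul c, forall i, eqt e (c i) & strict_seq c].
Proof.
move=> sY.
pose R n (h : nat -> Y -> M) (t : Y -> M) :=
  [/\ eqt e t, indep t (seq_tuple (fun k : 'I_n => h k)) & indep (seq_tuple (fun k : 'I_n => h k)) t].
have [||I IP] := @dependent_choice _ e R.
- move=> n h h' t hh'; rewrite /R; suff -> : (fun k : 'I_n => h k) = (fun k : 'I_n => h' k) by [].
  by apply/funext => k; exact: hh'.
- by move=> n h _; apply: strict_pair => //; sm.
have I1 i k : (i < k)%N -> indep (I k) (I i).
  by move=> ik; have [_ nk _] := IP k; exact: (indep_sub (f := id) (g := fun y => (Ordinal ik, y)) nk).
have I2 i k : (i < k)%N -> indep (I i) (I k).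
  by move=> ik; have [_ _ nk] := IP k; exact: (indep_sub (f := fun y => (Ordinal ik, y)) (g := id) nk).
have [c [cI cEM]] := extract hM sA nul I (small_nat hM) sY (small_void hM)
  (chain_irr chain_nat) (chain_trans chain_nat).
have cE i : eqt e (c i).
  move=> P dP Pe; apply: (extract_terms (c := I) (S := lt_nat) (R := lt_nat) (Q := fun u => P (u \o inl)) cEM).
    by apply: dfn_sub dP _; vars.
  by move=> k; have [E _ _] := IP k; exact: (E P dP Pe).
have cP (P : (Y + Y -> M) -> Prop) i m : definable A P ->
    covered (fun x => P (x +++ c i)) -> covered (fun x => P (x +++ I m)).
  move=> dP; apply: (covered_inv hM sA sY dP); apply: eqt_trans (eqt_sym (cE i)) _.
  by case: (IP m).
exists c; split=> // i j ij P dP Pij Cij.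
have [ij'|ji|/ij//] := ltngtP i j.
  have dP' : definable A (fun u : Y + Y -> M => P ((u \o inr) +++ (u \o inl))).
    by apply: dfn_sub dP _; vars.
  apply: (extract_pairs (b := c) (c := I) (S := lt_nat) (R := lt_nat) cEM (dfn_not dP') _ ij' Pij) => m m' mm' Pm.
  exact: (I2 m m' mm' P dP Pm (cP P j m' dP Cij)).
apply: (extract_pairs (b := c) (c := I) (S := lt_nat) (R := lt_nat) cEM (dfn_not dP) _ ji Pij) => m m' mm' Pm.
exact: (I1 m m' mm' P dP Pm (cP P j m dP Cij)).
Qed.

(** Kim's lemma. Dividing sequences through the terms of [c] are made successively
    indiscernible over one another and over the later terms, which triviality
    permits; [c] is the sequence of heads of the resulting array. *)
Lemma dividing_strict X Y (psi : (X + Y -> M) -> Prop) (e : Y -> M) (c : nat -> Y -> M) :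
  small K X -> small K Y -> definable A psi -> dividing psi e ->
  (forall i, eqt e (c i)) -> strict_seq c -> exists N, inconsistent_along psi N c.
Proof.
move=> sX sY dpsi [es [N [esI esE esN]]] cE cs.
pose tl n := seq_tuple (fun k => c (n.+1 + k)%N).
pose R n (h : nat -> nat -> Y -> M) (t : nat -> Y -> M) :=
  [/\ t 0%N = c n, eqt (seq_tuple es) (seq_tuple t) &
      indisc lt_nat (rows_before h (i := n) +++ tl n) t].
have [||I IP] := @dependent_choice _ es R.
- move=> n h h' t hh'; rewrite /R; suff -> : rows_before h (i := n) = rows_before h' (i := n) by [].
  by apply/funext => -[k p]; rewrite /rows_before /seq_tuple /= hh'.
- move=> n h hR.
  have nw : indep (rows_before h (i := n) +++ tl n) (c n).
    apply: (indep_cat hM sA hA hleft) => //; apply: (indep_seq hM sA hA hleft) => // k; last first.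
      by apply: cs; lia.
    apply: (indep_seq hM sA hA hleft) => // j.
    have [hk0 _ hkI] := hR k (ltn_ord k).
    have E : c (k.+1 + (n - k.+1))%N = c n by rewrite subnKC.
    have := indisc1 (i := 0%N) j hkI; rewrite hk0 => H.
    apply: (indep_inv hM sA (a := c k) (b := c n)) => //; last by apply: cs; have := ltn_ord k; lia.
    have := eqt_sub (F := fun u => (u \o inl) +++ (fun y => u (inr (inr ((n - k.+1)%N, y))))) H.
    rewrite -E; apply; by vars.
  have sw : small K ('I_n * (nat * Y) + nat * Y) by sm.
  have [t [tI tE t0]] := indep_move_start hM sA sw sY esI (eqt_trans (eqt_sym (esE 0%N)) (cE n)) nw.
  by exists t.
have I0 i : I i 0%N = c i by case: (IP i).
have rowI i j : eqt ((I i j +++ rows_before I (i := i)) +++ heads_after I i)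
      ((I i 0%N +++ rows_before I (i := i)) +++ heads_after I i).
  have [_ _ iI] := IP i.
  have -> : heads_after I i = tl i by apply/funext => -[k y]; rewrite /heads_after /tl /seq_tuple /= I0.
  apply: (eqt_sub (F := fun u => ((u \o inl) +++ (u \o inr \o inl)) +++ (u \o inr \o inr)) (indisc1 (i := j) 0%N iI)); vars.
have rows i x : exists j, ~ psi (x +++ I i j).
  have [_ E _] := IP i.
  by have [j] := inconsistent_eqt dpsi E esN x; exists j.
apply: (no_all_patterns hM sA hMT hNIP sX sY dpsi) => n s [x xP].
have [||x' x'P] := array_patterns (k := @nat_of_ord n) rowI s dpsi rows.
- exact: val_inj.
- by exists x => r; rewrite I0.
by exists x' => r; rewrite -I0.
Qed.

(** Forking is dividing. Otherwise [Q] is satisfied along a strict sequence in the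
    type of [b] and the parameters [z] of the covering; by the pigeonhole principle
    one of the dividing formulas is satisfied infinitely often, against Kim's
    lemma. *)
Lemma covered_dividing X Y (Q : (X + Y -> M) -> Prop) (b : Y -> M) :
  small K X -> small K Y -> definable A Q -> covered (fun x => Q (x +++ b)) -> dividing Q b.
Proof.
move=> sX sY dQ [m [z [n [psi [Hpsi C]]]]].
have sYm : small K (Y + 'I_m) by sm.
have [c [cI cE cs]] := strict_seq_exists (b +++ z) sYm.
apply: contrapT => nD.
have QN N : exists x, forall i : 'I_N, Q (x +++ (c i \o inl)).
  apply: contrapT => nx; apply: nD; exists (fun i => c i \o inl), N; split.
  - have := @indisc_sub _ _ A nat lt_nat _ Y void void inl id nul c cI; apply.
  - by move=> i; apply: (eqt_sub (F := fun u => u \o inl) (cE i)); vars.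
  by move=> x; apply: contrapT => nH; apply: nx; exists x => i; apply: contrapT => ?; apply: nH; exists i.
pose F := [set R : (X -> M) -> Prop | exists i, R = fun x => Q (x +++ (c i \o inl))].
have [||R [i ->]|k R FR|x xF] := @saturation _ _ _ hM A sA X (nat * (Y + 'I_m)) (seq_tuple c) F.
- by [].
- by sm.
- apply/dfn_param; exists (fun u => Q ((u \o inl) +++ (fun y => u (inr (i, inl y))))) => //.
  by apply: dfn_sub dQ _; vars.
- have /choice[r rP] := FR; have [x xP] := QN (\max_i r i).+1; exists x => i.
  rewrite rP; exact: (xP (Ordinal (leq_bigmax i : (r i < (\max_i r i).+1)%N))).
have xQ i : Q (x +++ (c i \o inl)) by apply: (xF (fun x => Q (x +++ (c i \o inl)))); exists i.
have /choice[j jP] : forall i, exists j : 'I_n, psi j (x +++ (c i \o inr)).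
  move=> i; have [j jn pj] := cE i _ (dfn_covering dQ (fun j jn => (Hpsi j jn).1)) C x (xQ i).
  by exists (Ordinal jn).
have [j0 [h [hi hj]]] := pigeonhole_inf j.
have [d0 D0] := Hpsi j0 (ltn_ord j0).
have [||N cN] := @dividing_strict X 'I_m (psi j0) z (fun i => c (h i) \o inr) sX (small_ord hM m) d0 D0.
- by move=> i; apply: (eqt_sub (F := fun u => u \o inr) (cE (h i))); vars.
- move=> i k ik; apply: (indep_sub (f := inr) (g := inr)); apply: cs => hik; apply: ik.
  by case: (ltngtP i k) => // /hi; rewrite hik ltnn.
by have [i] := cN x; apply; rewrite -(hj i); exact: jP.
Qed.

(** Otherwise [P(x,b)] without [chi(x,d)], where [chi(a,y)] forks, is covered, hence
    divides, and is inconsistent along a strict sequence in the type of [b] and [d].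
    But this sequence can be conjugated so that [a] satisfies [P] along it while all
    its terms are independent from [a]: the part of [b] by [indep_move_start] and
    the independence of [b] from [a], the part of [d] by [indep_left_ext]. *)
Lemma strict_ext X Y D (a : X -> M) (b : Y -> M) (d : D -> M) :
  small K X -> small K Y -> small K D -> indep a b -> indep b a ->
  exists a', [/\ eqt (a +++ b) (a' +++ b), indep a' d & indep d a'].
Proof.
move=> sX sY sD ab ba; apply: realize_two_sided => // P phi chi dP dphi dchi Pab Cphi Cchi H.
pose Q (u : X + (Y + D) -> M) := P ((u \o inl) +++ (u \o inr \o inl)) /\
  ~ chi ((u \o inl) +++ (u \o inr \o inr)).
have dQ : definable A Q.
  by apply: dfn_and; [apply: dfn_sub dP _|apply: dfn_not; apply: dfn_sub dchi _]; vars.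
have sYD : small K (Y + D) by sm.
have DQ : dividing Q (b +++ d).
  apply: covered_dividing => //; apply: covered_sub Cphi => x [Px nchi].
  by case: (H x Px).
have [c [cI cE cs]] := strict_seq_exists (b +++ d) sYD.
have [N cN] := dividing_strict sX sYD dQ DQ cE cs.
have bsI : indisc lt_nat nul (fun i => c i \o inl).
  have := @indisc_sub _ _ A nat lt_nat _ Y void void inl id nul c cI; apply.
have bE : eqt (c 0%N \o inl) b.
  by apply: eqt_sym; apply: (eqt_sub (F := fun u => u \o inl) (cE 0%N)); vars.
have [b' [b'I b'E b'0]] := indep_move_start hM sA sX sY bsI bE ab.
have bb' i : eqt (b +++ a) (b' i +++ a) by have := indisc1 (i := 0%N) i b'I; rewrite b'0.
have nb' : indep (seq_tuple b') a.
  apply: (indep_seq hM sA hA hleft) => // i.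
  exact: (indep_inv hM sA sX (bb' i) ba).
have [snY snD] : small K (nat * Y) /\ small K (nat * D) by split; sm.
have [d1 E1] := eqt_extend hM sA (seq_tuple (fun i => c i \o inr)) snY snD b'E.
have [d2 [E2 nd2]] := indep_left_ext d1 snY sX snD nb'.
have E := eqt_trans E1 E2.
pose R (u : nat * Y + nat * D -> M) := forall x, exists i : 'I_N,
  ~ Q (x +++ ((fun y => u (inl (nat_of_ord i, y))) +++ (fun y => u (inr (nat_of_ord i, y))))).
have dR : definable A R by apply: dfn_inconsistent => // i; vars.
have Rc : R (seq_tuple (fun i => c i \o inl) +++ seq_tuple (fun i => c i \o inr)).
  by move=> x; have [i ni] := cN x; exists i; rewrite -(cat_tuple_eta (c i)) in ni.
have [i nQ] := E R dR Rc a; apply: nQ; split.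
  have := eqt_sub (F := fun u => (u \o inr) +++ (u \o inl)) (bb' i).
  by move=> /(_ _ P dP Pab); apply; vars.
move=> chii; have := indep_sub (f := fun y => (nat_of_ord i, y)) (g := id) nd2.
move=> /(_ (fun u => chi ((u \o inr) +++ (u \o inl)))); apply => //.
by apply: dfn_sub dchi _; vars.
Qed.

End Consequences.

Import Order.TTheory.

Section Main.
Variables (L : language) (K : Type) (M : structure L) (hM : monster K M).
Variables (A : set M) (sA : small_set K A).
Variables (T : theory L) (hMT : models M T) (hNIP : NIP T).

Local Notation eqt := (eqt A).
Local Notation indisc := (indisc A).
Local Notation nul := (of_void M).
Local Notation indep := (indep A).
Local Notation dividing := (dividing A).
Local Notation covered := (covered A).

Variables (hA : extension_base K A) (hleft : left_totally_trivial K A).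

(** * Infinite linear orders *)

Lemma indisc_rev J (R : J -> J -> Prop) Y W (w : W -> M) (a : J -> Y -> M) :
  indisc R w a -> indisc (fun x y => R y x) w a.
Proof.
move=> H n i j ii jj.
have rev_incr (f : 'I_n -> J) : (forall k l : 'I_n, (k < l)%N -> R (f l) (f k)) ->
    forall k l : 'I_n, (k < l)%N -> R ((f \o @rev_ord n) k) ((f \o @rev_ord n) l).
  move=> fi k l kl; apply: fi => /=; have := ltn_ord l; have := ltn_ord k.
  by rewrite /=; lia.
have := eqt_sub (F := fun e => (fun u : 'I_n * Y => e (inl (rev_ord u.1, u.2))) +++ (e \o inr))
  (H n _ _ (rev_incr i ii) (rev_incr j jj)).
have E f : (fun e : 'I_n * Y + W -> M => (fun u : 'I_n * Y => e (inl (rev_ord u.1, u.2))) +++ (e \o inr))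
   (((fun u : 'I_n * Y => a ((f \o @rev_ord n) u.1) u.2)) +++ w) =
   (fun u : 'I_n * Y => a (f u.1) u.2) +++ w.
  by apply/funext => -[[k y]|v] //=; rewrite rev_ordK.
rewrite !E; apply; by vars.
Qed.

Lemma order_list d (J : orderType d) n (f : 'I_n -> J) :
  exists m (i : 'I_m -> J), (forall k l : 'I_m, (k < l)%N -> (i k < i l)%O) /\
    forall k, exists l, i l = f k.
Proof.
case: n f => [|n] f.
  by exists 0%N, f; split=> -[].
pose s := sort <=%O (undup (codom f)).
have ss : sorted <%O s by rewrite lt_sorted_uniq_le sort_uniq undup_uniq sort_le_sorted.
exists (size s), (fun k => nth (f ord0) s k); split=> [k l kl|k].
  by rewrite (lt_sorted_ltn_nth _ ss) // inE ltn_ord.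
have fs : f k \in s by rewrite mem_sort mem_undup codom_f.
have ls : (index (f k) s < size s)%N by rewrite index_mem.
by exists (Ordinal ls); rewrite /= nth_index.
Qed.

(** By Ramsey's theorem for pairs, an infinite linear order contains a monotone
    sequence. *)
Lemma order_chain d (J : orderType d) : infinite_set [set: J] ->
  exists (R : J -> J -> Prop) h, chain R h /\
    forall Y W (w : W -> M) (a : J -> Y -> M),
      indisc (fun x y : J => is_true (x < y)%O) w a <-> indisc R w a.
Proof.
move=> /infiniteP /card_leTP[f finj].
have [h [hi hP]] := ramsey (fun i : 'I_2 -> nat => (f (i ord0) < f (i ord_max))%O).
pose pr (x y : nat) (r : 'I_2) := if r == ord0 then x else y.
have pri x y : (x < y)%N -> forall k l : 'I_2, (k < l)%N -> (pr x y k < pr x y l)%N.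
  by move=> xy [[|[|//]] ?] [[|[|//]] ?].
have prE x y z t : (x < y)%N -> (z < t)%N -> (f (h x) < f (h y))%O <-> (f (h z) < f (h t))%O.
  by move=> xy zt; exact: (hP (pr x y) (pr z t) (pri _ _ xy) (pri _ _ zt)).
have [f01|f10] := boolP (f (h 0%N) < f (h 1%N))%O.
  exists (fun x y : J => is_true (x < y)%O), (f \o h); split; last by [].
  split.
  - by move=> x; rewrite ltxx.
  - by move=> x y z; exact: lt_trans.
  - by move=> i j ij; apply/(prE i j 0%N 1%N).
  - exact: order_list.
exists (fun x y : J => is_true (y < x)%O), (f \o h); split; last first.
  by move=> Y W w a; split=> H; exact: indisc_rev H.
split.
- by move=> x; rewrite ltxx.
- by move=> x y z xy yz; exact: lt_trans yz xy.
- move=> i j ij /=; have nij : ~ (f (h i) < f (h j))%O.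
    by move=> /(prE i j 0%N 1%N ij isT); apply/negP.
  have [/nij//|//|/finj E] := ltgtP (f (h i)) (f (h j)).
  by have := hi i j ij; rewrite E ltnn.
- move=> n g; have [m [i [ii il]]] := order_list g.
  exists m, (i \o @rev_ord m); split=> [k l kl|k].
    by apply: ii => /=; have := ltn_ord l; have := ltn_ord k; lia.
  by have [l <-] := il k; exists (rev_ord l); rewrite /= rev_ordK.
Qed.

(** * Global types *)

Lemma consistent_fin X (p : set (formula L (X + M))) (F : finType) (f : F -> formula L (X + M)) :
  consistent p -> (forall i, p (f i)) -> exists c, forall i, holds c (f i).
Proof.
move=> cp pf; have [c cP] := cp #|{: F}| (fun i => f (enum_val i)) (fun i => pf (enum_val i)).
by exists c => i; have := cP (enum_rank i); rewrite enum_rankK.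
Qed.

Lemma consistent_not X (p : set (formula L (X + M))) phi :
  consistent p -> p (Not phi) -> ~ p phi.
Proof.
move=> cp pn pphi; have [|c cP] := cp 2%N (fun i => if i == ord0 then phi else Not phi).
  by move=> i; case: ifP.
exact: (cP ord_max (cP ord0)).
Qed.

Lemma complete_extension X (G : set (formula L (X + M))) : consistent G ->
  exists p, global_type p /\ G `<=` p.
Proof.
move=> cG.
have [C CP Ctot n f fP|S [cS Smax]] := @Zorn_bigcup _ (fun S => consistent (G `|` S)).
  have [S [SP fS]] : exists S, consistent (G `|` S) /\ forall i, (G `|` S) (f i).
    suff [S [SC fS]] : exists S, (C S \/ S = set0) /\ forall i, (G `|` S) (f i).
      exists S; split=> //; case: SC => [/CP //|->]; by rewrite setU0.
    elim: n f fP => [|n IH] f fP; first by exists set0; split; [right|case].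
    have [S [SC fS]] := IH (f \o lift ord0) (fun i => fP _).
    have [Gf|[S' CS' S'f]] := fP ord0.
      exists S; split=> // i; case: (unliftP ord0 i) => [j|] ->; [exact: fS|by left].
    case: SC => [CS|S0]; last first.
      exists S'; split; first by left.
      move=> i; case: (unliftP ord0 i) => [j|] ->; last by right.
      by left; case: (fS j) => //; rewrite S0.
    have [SS'|S'S] := Ctot S S' CS CS'.
      exists S'; split; first by left.
      move=> i; case: (unliftP ord0 i) => [j|] ->; last by right.
      by case: (fS j); [left|right; exact: SS'].
    exists S; split; first by left.
    by move=> i; case: (unliftP ord0 i) => [j|] ->; [exact: fS|right; exact: S'S].
  exact: SP.
exists (G `|` S); split; last by move=> phi; left.
split=> // phi; apply: contrapT => /not_orP[np nnp].
have ext psi : ~ (G `|` S) psi -> exists (F : finType) (f : F -> formula L (X + M)),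
    (forall i, (G `|` S) (f i)) /\ forall c, (forall i, holds c (f i)) -> ~ holds c psi.
  move=> npsi; have : ~ consistent (G `|` (S `|` [set psi])).
    apply: Smax; split; first by move=> th; left.
    by move=> /(_ psi) H; apply: npsi; right; apply: H; right.
  move=> /existsNP[n /existsNP[f /not_implyP[fP nc]]].
  exists {i : 'I_n | `[< (G `|` S) (f i) >]}, (fun i => f (val i)); split.
    by move=> [i /= /asboolP].
  move=> c cP cpsi; apply: nc; exists c => i.
  have [Gi|nGi] := pselect ((G `|` S) (f i)).
    exact: (cP (exist _ i (introT (asboolP _) Gi))).
  case: (fP i) => [Gi|[Si|->//]]; case: nGi; [by left|by right].
have [F [f [fP fN]]] := ext _ np; have [F' [f' [f'P f'N]]] := ext _ nnp.
have [|c cP] := @consistent_fin X (G `|` S) (F + F')%type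
  (fun i => match i with inl i => f i | inr i => f' i end) cS; first by case.
apply: (f'N c (fun i => cP (inr i))).
exact: (fN c (fun i => cP (inl i))).
Qed.

(** * The equivalences *)

Section Equivalences.
Variables (X Y : Type) (a : X -> M) (b : Y -> M) (sX : small K X) (sY : small K Y).

Lemma strict_nonforking_indep : strict_nonforking K a A b -> indep a b /\ indep b a.
Proof.
move=> [p [[pc pm] ap np pB]]; split.
  apply/(nonforkingP hM sA) => -[phi [[n [f [fP H]]] F]]; apply: np; exists phi; split=> //.
  by exists n, f; split=> // i; apply: ap; exact: fP.
have sB : small_set K (A `|` range b) by apply: (small_setU hM) => //; exact: small_range.
have BV : A `|` range b `<=` A `|` range b by [].
have aB : realizes a (Defs.restrict p (A `|` range b)).
  move=> phi [pphi Bphi]; apply: contrapT => nphi.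
  apply: (consistent_not pc) pphi; apply: ap.
  by split=> // m [/Bphi|].
have bB y : b y \in A `|` range b by apply: mem_set; right; exists y.
have /(nonforkingP hM sA) H := pB (A `|` range b) sB BV a aB.
exact: (indep_sub (f := fun y => SigSub (bB y)) (g := id) H).
Qed.

(** The type [p] completes the conditions that exclude forking on either side; by
    [strict_ext], those on finitely many parameters are consistent. On the side of
    the parameters, triviality allows one element [m] at a time. *)
Lemma indep_strict_nonforking : indep a b -> indep b a -> strict_nonforking K a A b.
Proof.
move=> ab ba.
pose G1 := tp a (A `|` range b).
pose G2 := [set th : formula L (X + M) | exists2 phi, th = Not phi & formula_forks A phi].
pose G3 := [set th : formula L (X + M) | exists phi m (P : (unit + X -> M) -> Prop),
  [/\ th = Not phi, definable A P, covered (fun y => P (y +++ a)) &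
      forall x, holds x phi <-> P ((fun=> m) +++ x)]].
have [|p [pg Gp]] := @complete_extension X (G1 `|` (G2 `|` G3)).
  move=> n phi phiG.
  have [F [f fP]] := fin_covered_bigU (fun i => fv_fin (phi i)).
  have /choice[m mP] : forall i, exists m, G3 (phi i) -> exists psi (P : (unit + X -> M) -> Prop),
      [/\ phi i = Not psi, definable A P, covered (fun y => P (y +++ a)) &
      forall x, holds x psi <-> P ((fun=> m) +++ x)].
    move=> i; have [[psi [m [P H]]]|nG] := pselect (G3 (phi i)).
      by exists m => _; exists psi, P.
    by have [m0] := carrier_inhabited M; exists m0.
  have [m0] := carrier_inhabited M.
  pose d (u : F + 'I_n) := match u with inl k => if f k is inr r then r else m0 | inr i => m i end.
  have sF : small K F.
    apply: (small_embeds _ (small_ord hM #|F|)); exists enum_rank; exact: enum_rank_inj.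
  have [a' [Ea nad nda]] := strict_ext hM sA hMT hNIP hA hleft d sX sY (small_sum hM sF (small_ord hM n)) ab ba.
  exists a' => i; case: (phiG i) => [[B Hphi]|[[psi E Fpsi]|G3i]].
  - have [|Q dQ QE] := (@dfn_param _ _ A X Y b (fun x => holds x (phi i))).1; first by exists (phi i).
    by apply/QE; apply: (Ea Q dQ); apply/QE.
  - rewrite E => psia'.
    have [|Q dQ QE] := (@dfn_param _ _ A X _ d (fun x => holds x psi)).1.
      exists psi; split=> // r Hr; right; have [|k fk] := fP (inr r).
        by exists i; rewrite E; left.
      by exists (inl k) => //=; rewrite fk.
    apply: (nad Q dQ); first exact/QE.
    by apply: covered_sub (formula_forks_covered hM sA Fpsi) => x /QE.
  have [psi [P [E dP cP psiE]]] := mP i G3i.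
  rewrite E => /psiE Pma.
  have nm : indep (fun _ : unit => m i) a'.
    exact: (indep_sub (f := fun=> inr i) (g := id) nda).
  apply: (nm P dP Pma); apply: (covered_inv hM sA sX dP) cP.
  by apply: (eqt_sub (F := fun u => u \o inl) Ea); vars.
have [pc pm] := pg.
exists p; split=> //.
- by move=> phi Hphi; apply: Gp; left.
- move=> [phi [[n [f [fP H]]] Fphi]].
  have pnphi : p (Not phi) by apply: Gp; right; left; exists phi.
  have [|c cP] := @consistent_fin X p ('I_n + unit)%type
    (fun u => match u with inl i => f i | inr _ => Not phi end) pc; first by case.
  exact: (cP (inr tt) (H c (fun i => cP (inl i)))).
move=> B sB AB c cP; apply/(nonforkingP hM sA).
apply: (indep_elem hM sA hA hleft sX) => m P dP Pmc cv.
have ac : eqt a c.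
  move=> Q [phi [Aphi phiE]] Qa; apply/phiE; apply: cP; split.
    by apply: Gp; left; split; [move=> r /Aphi; left|apply/phiE].
  by move=> r /Aphi Ar; apply: AB; left.
have cva : covered (fun y => P (y +++ a)).
  by apply: (covered_inv hM sA sX dP) cv; exact: eqt_sym.
have [phi [Bphi phiE]] : definable (A `|` range (fun _ : unit => val m)) (fun x => P ((fun=> val m) +++ x)).
  apply/dfn_param; exists (fun u => P ((u \o inr) +++ (u \o inl))) => //.
  by apply: dfn_sub dP _; vars.
have : holds c (Not phi).
  apply: cP; split; first by apply: Gp; right; right; exists phi, (val m), P.
  move=> r [/Bphi|//] [Ar|[_ _ <-]]; first by apply: AB; left.
  exact/set_mem/valP.
by apply; apply/phiE.
Qed.

(** The sequence through [b] is moved to be indiscernible over [a]; by triviality it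
    is independent from [a], so the sequence through [a] can be moved to be
    indiscernible over it. A last extraction makes the former indiscernible over the
    latter and preserves the converse, which is a property of increasing tuples. *)
Lemma indep_strictly_independent : indep a b -> indep b a ->
  strictly_independent K (pair_family a b) A.
Proof.
move=> ab ba d J I sJ infJ indI hI.
pose Ia : J true -> X -> M := I true; pose Ib : J false -> Y -> M := I false.
have [ja Iaja] : exists j, Ia j = a by have [j jP] := hI true; exists j.
have [jb Ibjb] : exists j, Ib j = b by have [j jP] := hI false; exists j.
have [Ra [ha [cha Raw]]] := order_chain (infJ true).
have [Rb [hb [chb Rbw]]] := order_chain (infJ false).
have [sJa sJb] : small K (J true) /\ small K (J false) by [].
have IaI : indisc Ra nul Ia.
  apply/Raw; have := indI true; rewrite -[in indiscernible A _](range_nul A).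
  by move=> /indiscernibleP.
have IbI : indisc Rb nul Ib.
  apply/Rbw; have := indI false; rewrite -[in indiscernible A _](range_nul A).
  by move=> /indiscernibleP.
have ab' : indep a (Ib jb) by rewrite Ibjb.
have [Ib1 [Ib1I Ib1E Ib1j]] := indep_move hM sA sJb sX sY chb IbI ab'.
rewrite Ibjb in Ib1j.
have bb1 j : eqt (b +++ a) (Ib1 j +++ a) by have := indisc1 (i := jb) j Ib1I; rewrite Ib1j.
have nb1 : indep (seq_tuple Ib1) (Ia ja).
  rewrite Iaja; apply: (indep_seq hM sA hA hleft) => // j.
  exact: (indep_inv hM sA sX (bb1 j) ba).
have sJY : small K (J false * Y) by sm.
have sJX : small K (J true * X) by sm.
have [Ia1 [Ia1I Ia1E Ia1j]] := indep_move hM sA sJa sJY sX cha IaI nb1.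
rewrite Iaja in Ia1j.
have [Ib2 [Ib2I Ib2E EM]] := extract_like hM sA (seq_tuple Ia1) sJb sY sJX chb (indisc_nul Ib1I).
have Ia1I2 : indisc Ra (seq_tuple Ib2) Ia1.
  move=> n i j ii jj.
  suff H : eqt (seq_tuple Ib2 +++ seq_tuple (Ia1 \o i)) (seq_tuple Ib2 +++ seq_tuple (Ia1 \o j)).
    by apply: (eqt_sub (F := fun u => (u \o inr) +++ (u \o inl)) H); vars.
  apply: (eqt_chain chb) => m k kk P dP.
  pose Q (u : 'I_m * Y + J true * X -> M) :=
    P ((u \o inl) +++ (fun v : 'I_n * X => u (inr (i v.1, v.2)))) ->
    P ((u \o inl) +++ (fun v : 'I_n * X => u (inr (j v.1, v.2)))).
  have dQ : definable A Q by apply: dfn_imp; apply: dfn_sub dP _; vars.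
  apply: (EM m Q dQ _ k kk) => k' kk'.
  have H : eqt (seq_tuple (Ib1 \o k') +++ seq_tuple (Ia1 \o i)) (seq_tuple (Ib1 \o k') +++ seq_tuple (Ia1 \o j)).
    by apply: (eqt_sub (F := fun u => (fun v : 'I_m * Y => u (inr (k' v.1, v.2))) +++ (u \o inl)) (Ia1I n i j ii jj)); vars.
  exact: H.
have E2 : eqt (Ib2 jb +++ a) (b +++ a).
  apply: eqt_sym => P dP Pba.
  have := extract_terms (S := Rb) (R := Rb) EM (Q := fun u => P ((u \o inl) +++ (fun x => u (inr (ja, x))))).
  have E (c : J false -> Y -> M) j : ((c j +++ seq_tuple Ia1) \o inl) +++
     (fun x => (c j +++ seq_tuple Ia1) (inr (ja, x))) = c j +++ a by rewrite -Ia1j.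
  move=> /(_ _ _ jb); rewrite E; apply; first by apply: dfn_sub dP _; vars.
  by move=> j; rewrite E; exact: (bb1 j P dP Pba).
have sYX : small K (Y + X) by sm.
have [e eP] := eqt_extend hM sA (seq_tuple Ia1 +++ seq_tuple Ib2) sYX (small_sum hM sJX sJY) E2.
pose Ia3 j x := e (inl (j, x)); pose Ib3 j y := e (inr (j, y)).
have eE : e = seq_tuple Ia3 +++ seq_tuple Ib3 by apply/funext => -[[]|[]].
rewrite {}eE in eP.
have Ia3j : Ia3 ja = a.
  apply/funext => x; apply/esym.
  by apply: (eqt_coord (v := inl (inr x)) (w := inr (inl (ja, x))) eP); rewrite /= /seq_tuple Ia1j.
have Ib3j : Ib3 jb = b.
  by apply/funext => y; apply/esym; apply: (eqt_coord (v := inl (inl y)) (w := inr (inr (jb, y))) eP).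
have aE : eqt (seq_tuple Ia) (seq_tuple Ia3).
  by apply: eqt_trans Ia1E _; apply: (eqt_sub (F := fun u => u \o inr \o inl) eP); vars.
have bE : eqt (seq_tuple Ib) (seq_tuple Ib3).
  apply: eqt_trans Ib1E _; apply: eqt_trans Ib2E _.
  by apply: (eqt_sub (F := fun u => u \o inr \o inr) eP); vars.
exists (fun s => if s return J s -> pair_index X Y s -> M then Ia3 else Ib3); split.
  case; apply/eqt_rangeP; apply: eqt_sym.
    have := eqt_sub (F := fun u => u +++ (fun x => u (ja, x))) aE.
    have E (c : J true -> X -> M) : (fun x => seq_tuple c (ja, x)) = c ja by [].
    rewrite !E Iaja Ia3j; apply; by vars.
  have := eqt_sub (F := fun u => u +++ (fun y => u (jb, y))) bE.
  have E (c : J false -> Y -> M) : (fun y => seq_tuple c (jb, y)) = c jb by [].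
  rewrite !E Ibjb Ib3j; apply; by vars.
case.
  have -> : [set m | exists t, t <> true /\ range (seq_tuple
      ((if t as s return J s -> pair_index X Y s -> M then Ia3 else Ib3))) m] = range (seq_tuple Ib3).
    by apply/seteqP; split=> [m [[] []//]|m ?]; exists false.
  apply/indiscernibleP/Raw; apply: indisc_inv Ia1I2.
  by apply: (eqt_sub (F := fun u => u \o inr) eP); vars.
have -> : [set m | exists t, t <> false /\ range (seq_tuple
    ((if t as s return J s -> pair_index X Y s -> M then Ia3 else Ib3))) m] = range (seq_tuple Ia3).
  by apply/seteqP; split=> [m [[] []//]|m ?]; exists true.
apply/indiscernibleP/Rbw; apply: indisc_inv Ib2I.
by apply: (eqt_sub (F := fun u => (u \o inr \o inr) +++ (u \o inr \o inl)) eP); vars.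
Qed.

End Equivalences.

(** The premise prevents the type of [a] over [b] from dividing, and forking is
    dividing. *)
Lemma indep_of_indisc X Y (a : X -> M) (b : Y -> M) : small K X -> small K Y ->
  (forall es, indisc lt_nat nul es -> es 0%N = b ->
     exists es', eqt (seq_tuple es) (seq_tuple es') /\ es' 0%N = b /\ indisc lt_nat a es') ->
  indep a b.
Proof.
move=> sX sY H P dP Pab cP.
have [es [N [esI esE esN]]] := covered_dividing hM sA hMT hNIP hA hleft sX sY dP cP.
have [|es1 [es1I es1E es10]] := indep_move_start hM sA (small_void hM) sY esI (eqt_sym (esE 0%N)) (a := nul).
  exact: (indep_nul hM sA hA).
have [es2 [es2E [es20 es2I]]] := H es1 es1I es10.
have [i] := inconsistent_eqt dP (eqt_trans es1E es2E) esN a; apply.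
have := indisc1 (i := 0%N) i es2I; rewrite es20 => E.
suff abi : eqt (a +++ b) (a +++ es2 i) by exact: (abi P dP Pab).
by apply: (eqt_sub (F := fun u => (u \o inr) +++ (u \o inl)) E); vars.
Qed.

Lemma strictly_independent_indep X Y (a : X -> M) (b : Y -> M) : small K X -> small K Y ->
  strictly_independent K (pair_family a b) A -> indep a b /\ indep b a.
Proof.
move=> sX sY H.
have main (Ia : nat -> X -> M) (Ib : nat -> Y -> M) :
    indisc lt_nat nul Ia -> indisc lt_nat nul Ib -> Ia 0%N = a -> Ib 0%N = b ->
    exists (Ia' : nat -> X -> M) (Ib' : nat -> Y -> M),
    [/\ eqt (seq_tuple Ia +++ a) (seq_tuple Ia' +++ a), eqt (seq_tuple Ib +++ b) (seq_tuple Ib' +++ b),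
      indisc lt_nat (seq_tuple Ib') Ia' & indisc lt_nat (seq_tuple Ia') Ib'].
  move=> IaI IbI Ia0 Ib0.
  have [||||I' [I'E I'm]] := H (fun=> _) (fun=> nat) (fun s => if s return nat -> pair_index X Y s -> M then Ia else Ib).
  - by move=> s; exact: (small_nat hM).
  - by move=> s; exact: infinite_nat.
  - by case; apply/indiscernible_natP.
  - by case; exists 0%N.
  exists (I' true), (I' false); split.
  - by apply/eqt_rangeP; rewrite -(I'E true).
  - by apply/eqt_rangeP; rewrite -(I'E false).
  - have := I'm true.
    have -> : [set m | exists t, t <> true /\ range (seq_tuple (I' t)) m] = range (seq_tuple (I' false)).
      by apply/seteqP; split=> [m [[] []//]|m ?]; exists false.
    by move=> /indiscernibleP.
  have := I'm false.
  have -> : [set m | exists t, t <> false /\ range (seq_tuple (I' t)) m] = range (seq_tuple (I' true)).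
    by apply/seteqP; split=> [m [[] []//]|m ?]; exists true.
  by move=> /indiscernibleP.
(* One of the two sequences is taken constant. *)
have cst Z (c : Z -> M) : indisc lt_nat nul (fun=> c) by move=> n i j _ _; exact: eqt_refl.
have fst0 Z (I I' : nat -> Z -> M) (c : Z -> M) : I 0%N = c ->
    eqt (seq_tuple I +++ c) (seq_tuple I' +++ c) -> I' 0%N = c.
  move=> I0 E; apply/funext => z.
  by apply: (eqt_coord (v := inl (0%N, z)) (w := inr z) E); rewrite /= /seq_tuple I0.
split; apply: indep_of_indisc => // es esI es0.
  have [Ia' [Ib' [Ea Eb _ Ib'I]]] := main (fun=> a) es (cst _ a) esI erefl es0.
  exists Ib'; split; first by apply: (eqt_sub (F := fun u => u \o inl) Eb); vars.
  split; first exact: fst0 es0 Eb.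
  have := @indisc_sub _ _ A nat lt_nat Y Y _ X id (fun x => (0%N, x)) (seq_tuple Ia') Ib' Ib'I.
  by rewrite -[X in indisc _ X](_ : Ia' 0%N = _) // (fst0 _ (fun=> a) Ia' a).
have [Ia' [Ib' [Ea Eb Ia'I _]]] := main es (fun=> b) esI (cst _ b) es0 erefl.
exists Ia'; split; first by apply: (eqt_sub (F := fun u => u \o inl) Ea); vars.
split; first exact: fst0 es0 Ea.
have := @indisc_sub _ _ A nat lt_nat X X _ Y id (fun x => (0%N, x)) (seq_tuple Ib') Ia' Ia'I.
by rewrite -[X in indisc _ X](_ : Ib' 0%N = _) // (fst0 _ (fun=> b) Ib' b).
Qed.

End Main.

Theorem corollary4p7 (L : language) (T : theory L) (K : Type) (M : structure L)
    (hT : complete_theory T) (hMT : models M T) (hM : monster K M)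
    (hNIP : NIP T) (A : set M) (hA : extension_base K A)
    (hleft : left_totally_trivial K A)
    (X Y : Type) (a : X -> M) (b : Y -> M) (hX : small K X) (hY : small K Y) :
  (strict_nonforking K a A b <->
   nonforking a A (range b) /\ nonforking b A (range a)) /\
  (nonforking a A (range b) /\ nonforking b A (range a) <->
   strictly_independent K (pair_family a b) A).
Proof.
have sA := hA.1; rewrite !(nonforkingP hM sA); split; split.
- exact: (strict_nonforking_indep hM sA hY).
- by move=> [ab ba]; exact: (indep_strict_nonforking hM sA hMT hNIP hA hleft hX hY).
- by move=> [ab ba]; exact: (indep_strictly_independent hM sA hA hleft hX hY).
- exact: (strictly_independent_indep hM sA hMT hNIP hA hleft hX hY).
Qed.
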